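(* Let $A$ be a ring, ${}_AN_A$ an $A$-$A$-bimodule, and let $\Lambda_{(0,0)}=\begin{pmatrix}A & N\\ N & A\end{pmatrix}$ be the Morita ring with zero bimodule homomorphisms, assumed to be an Artin algebra. Assume that: (i) $N_A$ and ${}_AN$ are projective; (ii) $N\otimes_AN=0$. If $A$ is Gorenstein, then the ring $\Lambda_{(0,0)}$ is Gorenstein. In particular, if $\mathrm{gl.dim}\,A<\infty$, then $\mathrm{gl.dim}\,\Lambda_{(0,0)}<\infty$.
   Context: $\Lambda_{(0,0)}$ is $A\oplus N\oplus N\oplus A$ as an abelian group, written as $2\times2$ matrices, with multiplication $\begin{pmatrix}a & n\\ m & b\end{pmatrix}\begin{pmatrix}a' & n'\\ m' & b'\end{pmatrix}=\begin{pmatrix}aa' & an'+nb'\\ ma'+bm' & bb'\end{pmatrix}$. It is an Artin algebra iff there is a commutative artinian ring $R$ such that $A$ is an Artin $R$-algebra and $N$ is finitely generated over $R$ with $R$ acting centrally on $N$. An Artin algebra $\Lambda$ is Gorenstein if $\mathrm{id}\,{}_\Lambda\Lambda<\infty$ and $\mathrm{id}\,\Lambda_\Lambda<\infty$. *)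

(* Defs.v *)
From HB Require Import structures.
From mathcomp Require Import all_boot all_algebra.
From mathcomp Require Import generic_quotient ring_quotient.
From mathcomp Require Import boolp.
From mathcomp Require Import freeg.

Set Implicit Arguments.
Unset Strict Implicit.
Unset Printing Implicit Defensive.

Import GRing.Theory.

Local Open Scope ring_scope.

(* Rings are unital and not necessarily commutative.  Left R-modules are     *)
(* [lmodType R]; right R-modules are left modules over the converse ring,    *)
(* [lmodType R^c], so that [a *: x] in such a module is read "x a".          *)

(** * Bimodules *)

HB.mixin Record Lmodule_isBimodule (A B : pzRingType) N
    of GRing.Lmodule A N := {
  rscale : N -> B -> N;
  rscalerA : forall x b c, rscale (rscale x b) c = rscale x (b * c);
  rscaler1 : forall x, rscale x 1 = x;
  rscalerDl : forall x b c, rscale x (b + c) = rscale x b + rscale x c;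
  rscalerDr : forall x y b, rscale (x + y) b = rscale x b + rscale y b;
  scaler_rscaler : forall a x b, rscale (a *: x) b = a *: rscale x b
}.

#[short(type="bimodType")]
HB.structure Definition Bimodule (A B : pzRingType) :=
  {N of GRing.Lmodule A N & Lmodule_isBimodule A B N}.

Arguments rscale {A B s}.

Section RightModule.
Variables (A B : pzRingType) (N : bimodType A B).

Definition right_mod : Type := N.

HB.instance Definition _ := GRing.Zmodule.on right_mod.

Let scale (b : B^c) (x : right_mod) : right_mod := rscale (x : N) b.

Fact right_mod_scalerA b c x : scale b (scale c x) = scale (b * c) x.
Proof. exact: rscalerA. Qed.
Fact right_mod_scale1r : left_id 1 scale.
Proof. exact: rscaler1. Qed.
Fact right_mod_scalerDr : right_distributive scale +%R.
Proof. by move=> b x y; apply: rscalerDr. Qed.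
Fact right_mod_scalerDl x : {morph scale^~ x : b c / b + c}.
Proof. by move=> b c; apply: rscalerDl. Qed.

HB.instance Definition _ := GRing.Zmodule_isLmodule.Build B^c right_mod
  right_mod_scalerA right_mod_scale1r right_mod_scalerDr right_mod_scalerDl.

End RightModule.

(** * Tensor product of a right and a left module *)

Section Tensor.
Variables (A : pzRingType) (X : lmodType A^c) (Y : lmodType A).

Local Notation gen x y := (<< (x, y) >> : {freeg (X * Y)%type}).

Inductive tensor_rel : {freeg (X * Y)%type} -> Prop :=
| tensor_relDl x x' y : tensor_rel (gen (x + x') y - gen x y - gen x' y)
| tensor_relDr x y y' : tensor_rel (gen x (y + y') - gen x y - gen x y')
| tensor_relZ x (a : A) y :
    tensor_rel (gen ((a : A^c) *: x) y - gen x (a *: y))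
| tensor_rel0 : tensor_rel 0
| tensor_relB u v : tensor_rel u -> tensor_rel v -> tensor_rel (u - v).

Definition tensor_relb : {pred {freeg (X * Y)%type}} :=
  fun u => `[< tensor_rel u >].

Fact tensor_relb_zmod : zmod_closed tensor_relb.
Proof.
split=> [|u v /asboolP ru /asboolP rv]; apply/asboolP.
  exact: tensor_rel0.
exact: tensor_relB.
Qed.

HB.instance Definition _ := GRing.isZmodClosed.Build _ tensor_relb
  tensor_relb_zmod.

Definition tensor : zmodType := Quotient.quot tensor_relb.

Definition tens (x : X) (y : Y) : tensor := \pi_tensor%qT (gen x y).

Fact tensDl x x' y : tens (x + x') y = tens x y + tens x' y.
Proof.
apply/eqP; rewrite /tens -raddfD -Quotient.idealrBE opprD addrA.
exact/asboolP/tensor_relDl.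
Qed.

Fact tensDr x y y' : tens x (y + y') = tens x y + tens x y'.
Proof.
apply/eqP; rewrite /tens -raddfD -Quotient.idealrBE opprD addrA.
exact/asboolP/tensor_relDr.
Qed.

Fact tens_balanced x (a : A) y : tens ((a : A^c) *: x) y = tens x (a *: y).
Proof.
by apply/eqP; rewrite /tens -Quotient.idealrBE; apply/asboolP/tensor_relZ.
Qed.

End Tensor.

Definition zero_group (V : zmodType) : Prop := forall x : V, x = 0.

(** * The Morita ring with zero bimodule homomorphisms *)

Section Morita.
Variables (A : pzRingType) (N : bimodType A A).

(* ((a, n), (m, b)) is the matrix with rows (a n) and (m b). *)
Definition morita0 : Type := ((A * N) * (N * A))%type.

HB.instance Definition _ := GRing.Zmodule.on morita0.

Definition morita0_one : morita0 := ((1, 0), (0, 1)).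

Definition morita0_mul (x y : morita0) : morita0 :=
  let: ((a, n), (m, b)) := x in
  let: ((a', n'), (m', b')) := y in
  ((a * a', a *: n' + rscale n b'), (rscale m a' + b *: m', b * b')).

Fact rscale0r (b : A) : rscale (0 : N) b = 0.
Proof. by apply: (addrI (rscale 0 b)); rewrite -rscalerDr !addr0. Qed.

Fact rscaler0 (x : N) : rscale x (0 : A) = 0.
Proof. by apply: (addrI (rscale x 0)); rewrite -rscalerDl !addr0. Qed.

Fact morita0_mulA : associative morita0_mul.
Proof.
move=> [[a n] [m b]] [[a' n'] [m' b']] [[a2 n2] [m2 b2]] /=.
by rewrite !mulrA !scalerDr !rscalerDr !scalerA !rscalerA !scaler_rscaler !addrA.
Qed.

Fact morita0_mul1l : left_id morita0_one morita0_mul.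
Proof.
move=> [[a n] [m b]] /=.
by rewrite !mul1r !scale1r !rscale0r addr0 add0r.
Qed.

Fact morita0_mul1r : right_id morita0_one morita0_mul.
Proof.
move=> [[a n] [m b]] /=.
by rewrite !mulr1 !scaler0 !rscaler1 addr0 add0r.
Qed.

Fact morita0_mulDl : left_distributive morita0_mul +%R.
Proof.
move=> [[a n] [m b]] [[a' n'] [m' b']] [[a2 n2] [m2 b2]].
congr ((_, _), (_, _)) => /=; rewrite ?mulrDl ?scalerDl ?rscalerDr //.
all: by rewrite addrACA.
Qed.

Fact morita0_mulDr : right_distributive morita0_mul +%R.
Proof.
move=> [[a n] [m b]] [[a' n'] [m' b']] [[a2 n2] [m2 b2]].
congr ((_, _), (_, _)) => /=; rewrite ?mulrDr ?scalerDr ?rscalerDl //.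
all: by rewrite addrACA.
Qed.

HB.instance Definition _ := GRing.Zmodule_isPzRing.Build morita0
  morita0_mulA morita0_mul1l morita0_mul1r morita0_mulDl morita0_mulDr.

End Morita.

(** * Artin algebras *)

Definition ideal (R : comPzRingType) (I : R -> Prop) : Prop :=
  [/\ I 0, forall x y, I x -> I y -> I (x + y)
         & forall a x, I x -> I (a * x)].

Definition artinian (R : comPzRingType) : Prop :=
  forall I : nat -> R -> Prop,
    (forall n, ideal (I n)) ->
    (forall n x, I n.+1 x -> I n x) ->
    exists n, forall m, (n <= m)%N -> forall x, I m x <-> I n x.

(* The R-algebra structure on L is given by its structure morphism. *)
Definition artin_algebra_over (R : comPzRingType) (L : pzRingType)
    (f : {rmorphism R -> L}) : Prop :=
  [/\ artinian R,
      forall r x, f r * x = x * f r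
    & exists (k : nat) (g : 'I_k -> L),
        forall x, exists c : 'I_k -> R, x = \sum_(i < k) f (c i) * g i].

Definition artin_algebra (L : pzRingType) : Prop :=
  exists (R : comPzRingType) (f : {rmorphism R -> L}), artin_algebra_over f.

(** * Homological dimensions *)

Section Homological.
Variable R : pzRingType.

Definition surjective_map (S T : Type) (f : S -> T) : Prop :=
  forall y, exists x, f x = y.

Definition exact_at (U V W : lmodType R) (f : U -> V) (g : V -> W) : Prop :=
  forall v, g v = 0 <-> exists u, f u = v.

Definition projective (P : lmodType R) : Prop :=
  forall (U V : lmodType R) (g : {linear U -> V}) (f : {linear P -> V}),
    surjective_map g -> exists h : {linear P -> U}, forall x, g (h x) = f x.

Definition injective_mod (I : lmodType R) : Prop :=
  forall (U V : lmodType R) (g : {linear U -> V}) (f : {linear U -> I}),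
    injective g -> exists h : {linear V -> I}, forall x, h (g x) = f x.

(* pd M <= n: there is a projective resolution                             *)
(*   ... -> P 1 -> P 0 -> M -> 0  with  P i = 0 for i > n.                 *)
Definition pd_le (M : lmodType R) (n : nat) : Prop :=
  exists (P : nat -> lmodType R) (e : {linear P 0%N -> M})
         (d : forall i, {linear P i.+1 -> P i}),
    [/\ forall i, projective (P i),
        surjective_map e,
        exact_at (d 0%N) e,
        forall i, exact_at (d i.+1) (d i)
      & forall i, (n < i)%N -> zero_group (P i)].

(* id M <= n: there is an injective resolution                             *)
(*   0 -> M -> I 0 -> I 1 -> ...  with  I i = 0 for i > n.                 *)
Definition id_le (M : lmodType R) (n : nat) : Prop :=
  exists (I : nat -> lmodType R) (e : {linear M -> I 0%N})
         (d : forall i, {linear I i -> I i.+1}),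
    [/\ forall i, injective_mod (I i),
        injective e,
        exact_at e (d 0%N),
        forall i, exact_at (d i) (d i.+1)
      & forall i, (n < i)%N -> zero_group (I i)].

Definition finite_id (M : lmodType R) : Prop := exists n, id_le M n.

End Homological.

Definition finite_gldim (L : pzRingType) : Prop :=
  exists n, forall M : lmodType L, pd_le M n.

(* L^o and (L^c)^o are L as a left and as a right module over itself. *)
Definition gorenstein (L : pzRingType) : Prop :=
  finite_id (L^o : lmodType L) /\ finite_id ((L^c)^o : lmodType L^c).

(* Main.v *)
From HB Require Import structures.
From mathcomp Require Import all_boot all_algebra.
From mathcomp Require Import generic_quotient ring_quotient.
From mathcomp Require Import boolp functions.
From mathcomp Require Import freeg.
Require Import Defs.

(** Put [B = A x A] and let [pi : L -> B] be the projection of the Morita ring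
    [L] onto its diagonal, with kernel [K = N + N]; thus [L] is a split
    extension of [B] by [K], and [K (x)_B K = 0].  Being an Artin algebra, [L]
    has [N] finitely generated, so [L] and [K] have finite dual bases over [B]
    on both sides, and [L (x)_B -], [K (x)_B -], [Hom_B(L, -)], [Hom_B(K, -)]
    are exact.

    Since [K (x)_B K = 0], every L-module [M] has a short exact sequence
    [0 -> L (x)_B (K (x)_B M) -> L (x)_B M -> M -> 0], and dually
    [0 -> M -> Hom_B(L, M) -> Hom_B(L, Hom_B(K, M)) -> 0].  Induction preserves
    projectives, coinduction and [Hom_B(K, -)] preserve injectives, so mapping
    cones give [pd_L M <= gldim B + 1] and [id_L M <= id_B M + 1].  For [M = L]
    the B-module [L] is finitely generated projective, hence of finite injective
    dimension if [B] is. *)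

Set Implicit Arguments.
Unset Strict Implicit.
Unset Printing Implicit Defensive.

Import GRing.Theory.

Local Open Scope ring_scope.

(** * Linear maps, submodules and restriction of scalars *)

Section LinearMaps.
Variable R : pzRingType.

Definition lin (U V : lmodType R) (f : U -> V) (fP : linear f) :
    {linear U -> V} :=
  HB.pack f (GRing.isLinear.Build R U V *:%R f fP).

Definition lin_comp (U V W : lmodType R) (g : {linear V -> W})
    (f : {linear U -> V}) : {linear U -> W} := g \o f.

End LinearMaps.

Section Submodule.
Variables (R : pzRingType) (V : lmodType R) (P : V -> Prop).
Hypotheses (P0 : P 0) (PL : forall a x y, P x -> P y -> P (a *: x + y)).

Definition submod_pred of P 0 & (forall a x y, P x -> P y -> P (a *: x + y)) :
  {pred V} := fun x => `[< P x >].

Fact submod_pred_closed : submod_closed (submod_pred P0 PL).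
Proof.
split=> [|a x y /asboolP Px /asboolP Py]; apply/asboolP => //.
exact: PL.
Qed.

HB.instance Definition _ := GRing.isSubmodClosed.Build R V (submod_pred P0 PL)
  (GRing.submod_closed_semi submod_pred_closed).

Record submod := Submod {
  submod_val :> V;
  _ : submod_val \in submod_pred P0 PL
}.

HB.instance Definition _ := [isSub for submod_val].
HB.instance Definition _ := [Choice of submod by <:].
HB.instance Definition _ := [SubChoice_isSubLmodule of submod by <:].

Definition mk_submod x (Px : P x) : submod := Submod (asboolT Px).

Lemma submodP (x : submod) : P x.
Proof. by apply/asboolP; case: x. Qed.

Lemma submod_inj (x y : submod) : submod_val x = submod_val y -> x = y.
Proof. exact: val_inj. Qed.

Lemma submod_val_linear : linear submod_val.
Proof. by []. Qed.

End Submodule.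

Arguments submod {R V} P P0 PL.
Arguments submod_val {R V P P0 PL}.

Section Restriction.
Variables (R S : pzRingType) (f : {rmorphism R -> S}) (M : lmodType S).

Definition restr of {rmorphism R -> S} : Type := M.
Local Notation Mf := (restr f).

HB.instance Definition _ := GRing.Zmodule.on Mf.

Let scale (a : R) (x : Mf) : Mf := f a *: (x : M).

Fact restr_scalerA a b x : scale a (scale b x) = scale (a * b) x.
Proof. by rewrite /scale scalerA rmorphM. Qed.
Fact restr_scale1r : left_id 1 scale.
Proof. by move=> x; rewrite /scale rmorph1 scale1r. Qed.
Fact restr_scalerDr : right_distributive scale +%R.
Proof. by move=> a x y; rewrite /scale scalerDr. Qed.
Fact restr_scalerDl x : {morph scale^~ x : a b / a + b}.
Proof. by move=> a b; rewrite /scale rmorphD scalerDl. Qed.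

HB.instance Definition _ := GRing.Zmodule_isLmodule.Build R Mf
  restr_scalerA restr_scale1r restr_scalerDr restr_scalerDl.

Lemma restr_scaleE (a : R) (x : Mf) : a *: x = f a *: (x : M).
Proof. by []. Qed.

End Restriction.

Arguments restr {R S} M f.

Section RestrictionMap.
Variables (R S : pzRingType) (f : {rmorphism R -> S}).
Variables (M M' : lmodType S) (g : {linear M -> M'}).

Fact restr_map_linear : linear (g : restr M f -> restr M' f).
Proof. by move=> a x y; apply: linearP. Qed.

Definition restr_map : {linear restr M f -> restr M' f} := lin restr_map_linear.

End RestrictionMap.

(** * Resolutions *)

Section Resolutions.
Variable R : pzRingType.
Implicit Types U V W : lmodType R.

Lemma exact_at_comp0 U V W (f : {linear U -> V}) (g : {linear V -> W}) x :
  exact_at f g -> g (f x) = 0.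
Proof. by move=> fg; apply/fg; exists x. Qed.

(** Corestricting both maps to the submodule [im] of values of [g] makes [g] surjective. The
    assumption has the form in which exactness of a resolution supplies it. *)
Lemma projective_lift (P U V : lmodType R) (g : {linear U -> V})
    (f : {linear P -> V}) :
  projective P -> (forall x, exists u, g u = f x) ->
  exists k : {linear P -> U}, forall x, g (k x) = f x.
Proof.
move=> projP gf; pose im w := exists v, g v = w.
have im0 : im 0 by exists 0; rewrite linear0.
have imL a x y : im x -> im y -> im (a *: x + y).
  by move=> [v <-] [w <-]; exists (a *: v + w); rewrite linearP.
have img u : im (g u) by exists u.
have glin : linear (fun u => mk_submod im0 imL (img u)).
  by move=> a x y; apply: submod_inj; rewrite /= linearP.
have flin : linear (fun x => mk_submod im0 imL (gf x)).
  by move=> a x y; apply: submod_inj; rewrite /= linearP.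
have [|k kP] := projP _ _ (lin glin) (lin flin).
  by move=> y; have [u gu] := submodP y; exists u; apply: submod_inj.
by exists k => x; have /(congr1 submod_val) := kP x.
Qed.

(** Since [f] kills the kernel of [h], it factors through the image of [h], and injectivity extends
    it from there. By [fh] the choice of the preimages [pre] does not matter. *)
Lemma injective_extend (I V W : lmodType R) (h : {linear V -> W})
    (f : {linear V -> I}) :
  injective_mod I -> (forall x, h x = 0 -> f x = 0) ->
  exists k : {linear W -> I}, forall x, k (h x) = f x.
Proof.
move=> injI hf0; pose im w := exists v, h v = w.
have im0 : im 0 by exists 0; rewrite linear0.
have imL a x y : im x -> im y -> im (a *: x + y).
  by move=> [v <-] [w <-]; exists (a *: v + w); rewrite linearP.
pose T := submod im im0 imL; pose pre (t : T) := projT1 (cid (submodP t)).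
have preK t : h (pre t) = submod_val t by rewrite /pre; case: cid.
have fh v w : h v = h w -> f v = f w.
  move=> hvw; apply/eqP; rewrite -subr_eq0 -linearB hf0 //.
  by rewrite linearB hvw subrr.
have flin : linear (fun t : T => f (pre t)).
  by move=> a x y; rewrite -linearP; apply: fh; rewrite linearP !preK.
have [|k kP] := injI _ _ (lin (@submod_val_linear _ _ im im0 imL)) (lin flin).
  by move=> x y; apply: submod_inj.
exists k => x; pose t : T := mk_submod im0 imL (ex_intro _ x erefl).
by have := kP t => /= ->; apply: fh; rewrite preK.
Qed.

End Resolutions.

(** This builds chain maps one degree at a time: [T j] holds the candidates in degree [j], and [Inv]
    records what the next extension requires. *)
Lemma dependent_choice (T : nat -> Type) (Inv : forall j, T j -> Prop)
    (Rel : forall j, T j -> T j.+1 -> Prop) (x0 : T 0%N) :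
  Inv 0%N x0 ->
  (forall j x, Inv j x -> exists2 y, Rel j x y & Inv j.+1 y) ->
  exists2 F : forall j, T j, F 0%N = x0 & forall j, Rel j (F j) (F j.+1).
Proof.
move=> I0 IS.
have next j (x : {x | Inv j x}) :
    {y : {y | Inv j.+1 y} | Rel j (proj1_sig x) (proj1_sig y)}.
  case: x => x Ix; have /cid2[y xy Iy] := IS _ _ Ix.
  by exists (exist _ y Iy).
pose G := nat_rect (fun j => {x | Inv j x}) (exist _ x0 I0)
  (fun j x => proj1_sig (next j x)).
exists (fun j => proj1_sig (G j)) => // j.
exact: (proj2_sig (next j (G j))).
Qed.

(** * Mapping cones and dimension shift along short exact sequences *)

Section Cones.
Variable R : pzRingType.
Implicit Types K L M : lmodType R.

Lemma projective_pair (P Q : lmodType R) :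
  projective P -> projective Q -> projective (P * Q)%type.
Proof.
move=> projP projQ U V g f surjg.
have f1lin : linear (fun x : P => f (x, 0)).
  by move=> a x y; rewrite -linearP; congr (f (_, _)); rewrite /= scaler0 addr0.
have f2lin : linear (fun x : Q => f (0, x)).
  by move=> a x y; rewrite -linearP; congr (f (_, _)); rewrite /= scaler0 addr0.
have [h1 h1E] := projP _ _ g (lin f1lin) surjg.
have [h2 h2E] := projQ _ _ g (lin f2lin) surjg.
have hlin : linear (fun x : P * Q => h1 x.1 + h2 x.2).
  by move=> a x y; rewrite /= !linearP scalerDr addrACA.
exists (lin hlin) => -[x y]; rewrite /= linearD h1E h2E /= -linearD.
by congr (f (_, _)); rewrite /= ?addr0 ?add0r.
Qed.

Lemma injective_pair (I J : lmodType R) :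
  injective_mod I -> injective_mod J -> injective_mod (I * J)%type.
Proof.
move=> injI injJ U V g f injg.
have [h1 h1E] := injI _ _ g (lin_comp fst f) injg.
have [h2 h2E] := injJ _ _ g (lin_comp snd f) injg.
have hlin : linear (fun x => (h1 x, h2 x)).
  by move=> a x y; rewrite !linearP.
by exists (lin hlin) => x; rewrite /= h1E h2E /=; case: (f x).
Qed.

Lemma zero_group_pair (U V : zmodType) :
  zero_group U -> zero_group V -> zero_group (U * V)%type.
Proof. by move=> U0 V0 [x y]; congr (_, _); [apply: U0 | apply: V0]. Qed.

(** The map [i] lifts to a chain map [f] from the resolution [Q] to [P]; its cone, with
    [P j.+1 * Q j] in degree [j.+1], resolves the cokernel [M]. The shift of [Q] costs the extra
    degree. *)
Lemma pd_le_cone K L M (i : {linear K -> L}) (p : {linear L -> M}) n :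
  injective i -> exact_at i p -> surjective_map p ->
  pd_le K n -> pd_le L n -> pd_le M n.+1.
Proof.
move=> inji exip surjp [Q [eQ [dQ [projQ surjQ exQ0 exQ zeroQ]]]].
move=> [P [eP [dP [projP surjP exP0 exP zeroP]]]].
have [f0 f0E] : exists f0 : {linear Q 0%N -> P 0%N},
    forall x, eP (f0 x) = i (eQ x).
  exact: (projQ 0%N _ _ eP (lin_comp i eQ)).
(* The composite of [dQ j] and [f] must land in the image of [dP j], as [projective_lift] asks. *)
pose Inv j (f : {linear Q j -> P j}) :=
  forall x, exists u, dP j u = f (dQ j x).
pose Rel j (f : {linear Q j -> P j}) (g : {linear Q j.+1 -> P j.+1}) :=
  forall x, dP j (g x) = f (dQ j x).
have [||f f0f fE] := @dependent_choice _ Inv Rel f0.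
- by move=> x; apply/exP0; rewrite f0E (exact_at_comp0 _ exQ0) linear0.
- move=> j f If.
  have [g gE] := projective_lift (g := dP j) (f := lin_comp f (dQ j))
    (projQ _) If.
  exists g => // x; apply/exP.
  by rewrite gE /= (exact_at_comp0 _ (exQ j)) linear0.
rewrite -{}f0f {f0} in f0E.
pose T j : lmodType R :=
  if j is j'.+1 then (P j'.+1 * Q j')%type else P 0%N.
have d0lin : linear (fun u : T 1%N => dP 0%N u.1 + f 0%N u.2).
  by move=> a x y; rewrite /= !linearP scalerDr addrACA.
(* The sign on [dQ j] makes consecutive differentials compose to zero. *)
have dSlin j : linear (fun u : T j.+2 =>
    (dP j.+1 u.1 + f j.+1 u.2, - dQ j u.2) : T j.+1).
  move=> a x y; congr (_, _); rewrite /= !linearP //.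
  by rewrite scalerDr addrACA.
pose d j : {linear T j.+1 -> T j} :=
  if j is j'.+1 return {linear T j.+1 -> T j} then lin (dSlin j')
  else lin d0lin.
exists T, (lin_comp p eP), d; split.
- by case=> [|j] //=; apply: projective_pair.
- by move=> y; have [l <-] := surjp y; have [x <-] := surjP l; exists x.
- move=> v; split=> [/exip[k ik]|[[x y] /= <-]].
    have [y ey] := surjQ k.
    have /exP0[x xE] : eP (v - f 0%N y) = 0 by rewrite linearB f0E ey ik subrr.
    by exists (x, y); rewrite /= xE subrK.
  rewrite linearD (exact_at_comp0 _ exP0) add0r f0E.
  exact: exact_at_comp0 exip.
- case=> [|j] [x y]; split=> /=.
  (* Injectivity of [i] enters here: [i (eQ y) = eP (f 0%N y) = - eP (dP 0%N x) = 0]. *)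
  + move=> xy0; have /exQ0[y' y'E] : eQ y = 0.
      apply: inji; rewrite -f0E linear0 -[f _ y](addKr (dP 0%N x)) xy0 addr0.
      by rewrite linearN (exact_at_comp0 _ exP0) oppr0.
    have /exP[x' x'E] : dP 0%N (x + f 1%N y') = 0 by rewrite linearD fE y'E.
    by exists (x', - y'); rewrite /= !linearN x'E addrK opprK y'E.
  + case=> -[x' y'] [<- <-]; rewrite linearD (exact_at_comp0 _ (exP _)) fE.
    by rewrite add0r linearN subrr.
  + case=> xy0 /eqP; rewrite oppr_eq0 => /eqP /exQ[y' y'E].
    have /exP[x' x'E] : dP j.+1 (x + f j.+2 y') = 0 by rewrite linearD fE y'E.
    by exists (x', - y'); rewrite /= !linearN x'E addrK opprK y'E.
  + case=> -[x' y'] [<- <-]; rewrite linearD (exact_at_comp0 _ (exP _)) fE.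
    by rewrite add0r !linearN subrr opprK (exact_at_comp0 _ (exQ _)).
- case=> [|j] // ltnj; apply: zero_group_pair; last exact: zeroQ.
  exact/zeroP/ltnW.
Qed.

(** Dually, [p] extends to a cochain map between injective resolutions, and the shifted cone
    resolves the kernel [M] of [p]. *)
Lemma id_le_cone M L K (i : {linear M -> L}) (p : {linear L -> K}) n :
  injective i -> exact_at i p -> surjective_map p ->
  id_le K n -> id_le L n -> id_le M n.+1.
Proof.
move=> inji exip surjp [Q [eQ [dQ [injQ injeQ exQ0 exQ zeroQ]]]].
move=> [P [eP [dP [injP injeP exP0 exP zeroP]]]].
have [f0 f0E] : exists f0 : {linear P 0%N -> Q 0%N},
    forall x, f0 (eP x) = eQ (p x).
  exact: (injQ 0%N _ _ eP (lin_comp eQ p)).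
pose Inv j (f : {linear P j -> Q j}) :=
  forall x, dP j x = 0 -> dQ j (f x) = 0.
pose Rel j (f : {linear P j -> Q j}) (g : {linear P j.+1 -> Q j.+1}) :=
  forall x, g (dP j x) = dQ j (f x).
have [||f f0f fE] := @dependent_choice _ Inv Rel f0.
- by move=> _ /exP0[l <-]; rewrite f0E (exact_at_comp0 _ exQ0).
- move=> j f If.
  have [g gE] := injective_extend (h := dP j) (f := lin_comp (dQ j) f)
    (injQ _) If.
  exists g => // _ /exP[x <-].
  by rewrite gE /= (exact_at_comp0 _ (exQ j)).
rewrite -{}f0f {f0} in f0E.
pose T j : lmodType R :=
  if j is j'.+1 then (P j'.+1 * Q j')%type else P 0%N.
have d0lin : linear (fun u => (dP 0%N u, f 0%N u) : T 1%N).
  by move=> a x y; rewrite !linearP.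
have dSlin j : linear (fun u : T j.+1 =>
    (dP j.+1 u.1, f j.+1 u.1 - dQ j u.2) : T j.+2).
  move=> a x y; congr (_, _); rewrite /= !linearP //.
  by rewrite scalerDr addrACA.
pose d j : {linear T j -> T j.+1} :=
  if j is j'.+1 return {linear T j -> T j.+1} then lin (dSlin j')
  else lin d0lin.
exists T, (lin_comp eP i), d; split.
- by case=> [|j] //=; apply: injective_pair.
- by move=> x y /= /injeP/inji.
- move=> v; split=> [[/exP0[l <-]]|[m /= <-]].
    rewrite f0E => eQpl; have /exip[m <-] : p l = 0.
      by apply: injeQ; rewrite linear0.
    by exists m.
  by congr (_, _); rewrite /= ?(exact_at_comp0 _ exP0) // f0E
    (exact_at_comp0 _ exip) linear0.
- case=> [|j] [x y]; split=> /=.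
  + case=> /exP[x' <-]; rewrite fE -linearB => /exQ0[k kE].
    (* Surjectivity of [p] writes [k] as [p l]; subtracting [eP l] corrects the second coordinate
       and leaves the first alone, since [dP 0%N] kills it. *)
    have [l plk] := surjp k; exists (x' - eP l) => /=.
    by rewrite !linearB /= (exact_at_comp0 _ exP0) subr0 f0E plk kE subKr.
  + by case=> x' [<- <-]; rewrite (exact_at_comp0 _ (exP _)) fE subrr.
  + case=> /exP[x' <-]; rewrite fE -linearB => /exQ[k kE].
    by exists (x', k); rewrite /= kE subKr.
  + case=> -[x' y'] [<- <-]; rewrite (exact_at_comp0 _ (exP _)) fE linearB.
    by rewrite (exact_at_comp0 _ (exQ _)) subr0 subrr.
- case=> [|j] // ltnj; apply: zero_group_pair; last exact: zeroQ.
  exact/zeroP/ltnW.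
Qed.

End Cones.

(** * Transport of resolutions along exact functors *)

Section ExactFunctors.
Variables (R S : pzRingType) (F : lmodType R -> lmodType S).
Variable Fm : forall X Y : lmodType R, {linear X -> Y} -> {linear F X -> F Y}.
Hypothesis Fzero : forall X : lmodType R, zero_group X -> zero_group (F X).
Hypothesis Fexact : forall (X Y Z : lmodType R) (f : {linear X -> Y})
  (g : {linear Y -> Z}), exact_at f g -> exact_at (Fm f) (Fm g).

Lemma pd_le_functor M n :
  (forall (X Y : lmodType R) (f : {linear X -> Y}), surjective_map f ->
    surjective_map (Fm f)) ->
  (forall P, projective P -> projective (F P)) ->
  pd_le M n -> pd_le (F M) n.
Proof.
move=> Fsurj Fproj [P [e [d [projP surje ex0 ex zeroP]]]].
exists (fun j => F (P j)), (Fm e), (fun j => Fm (d j)); split=> *.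
- exact: Fproj.
- exact: Fsurj.
- exact: Fexact.
- exact: Fexact.
- exact/Fzero/zeroP.
Qed.

Lemma id_le_functor M n :
  (forall (X Y : lmodType R) (f : {linear X -> Y}), injective f ->
    injective (Fm f)) ->
  (forall I, injective_mod I -> injective_mod (F I)) ->
  id_le M n -> id_le (F M) n.
Proof.
move=> Finj FI [P [e [d [injP inje ex0 ex zeroP]]]].
exists (fun j => F (P j)), (Fm e), (fun j => Fm (d j)); split=> *.
- exact: FI.
- exact: Finj.
- exact: Fexact.
- exact: Fexact.
- exact/Fzero/zeroP.
Qed.

End ExactFunctors.

(** * Dimensions of isomorphic modules, sums, powers and summands *)

Section DimensionLemmas.
Variable R : pzRingType.
Implicit Types M X Y : lmodType R.

Lemma pd_le_iso M X n (f : {linear M -> X}) :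
  injective f -> surjective_map f -> pd_le M n -> pd_le X n.
Proof.
move=> injf surjf [P [e [d [projP surje ex0 ex zeroP]]]].
exists P, (lin_comp f e), d; split=> //.
  by move=> x; have [m <-] := surjf x; have [y <-] := surje m; exists y.
move=> x; rewrite -(ex0 x); split=> [/= fex0 | /= ->]; last exact: linear0.
by apply: injf; rewrite linear0.
Qed.

Lemma id_le_iso M X n (f : {linear X -> M}) :
  injective f -> surjective_map f -> id_le M n -> id_le X n.
Proof.
move=> injf surjf [P [e [d [injP inje ex0 ex zeroP]]]].
exists P, (lin_comp e f), d; split=> //.
  by move=> x y /= /inje/injf.
move=> x; rewrite (ex0 x); split=> [[m <-]|[y <-]]; last by exists (f y).
by have [y <-] := surjf m; exists y.
Qed.

Lemma pd_le_pair X Y n : pd_le X n -> pd_le Y n -> pd_le (X * Y)%type n.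
Proof.
move=> [P [e [d [projP surje ex0 ex zeroP]]]].
move=> [Q [e' [d' [projQ surje' ex0' ex' zeroQ]]]].
have elin : linear (fun x : P 0%N * Q 0%N => (e x.1, e' x.2)).
  by move=> a x y; rewrite !linearP.
have dlin j : linear (fun x : P j.+1 * Q j.+1 => (d j x.1, d' j x.2)).
  by move=> a x y; rewrite !linearP.
exists (fun j => (P j * Q j)%type), (lin elin), (fun j => lin (dlin j)).
split=> *; do ?[exact: projective_pair | apply: zero_group_pair; auto].
- move=> [x y]; have [[u <-] [v <-]] := (surje x, surje' y).
  by exists (u, v).
- move=> [x y]; split=> /= [[/ex0[u <-] /ex0'[v <-]]|[[u v] [<- <-]]].
    by exists (u, v).
  by rewrite (exact_at_comp0 _ ex0) (exact_at_comp0 _ ex0').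
- move=> [x y]; split=> /= [[/ex[u <-] /ex'[v <-]]|[[u v] [<- <-]]].
    by exists (u, v).
  by rewrite (exact_at_comp0 _ (ex _)) (exact_at_comp0 _ (ex' _)).
Qed.

Lemma id_le_pair X Y n : id_le X n -> id_le Y n -> id_le (X * Y)%type n.
Proof.
move=> [P [e [d [injP inje ex0 ex zeroP]]]].
move=> [Q [e' [d' [injQ inje' ex0' ex' zeroQ]]]].
have elin : linear (fun x : X * Y => (e x.1, e' x.2)).
  by move=> a x y; rewrite !linearP.
have dlin j : linear (fun x : P j * Q j => (d j x.1, d' j x.2)).
  by move=> a x y; rewrite !linearP.
exists (fun j => (P j * Q j)%type), (lin elin), (fun j => lin (dlin j)).
split=> *; do ?[exact: injective_pair | apply: zero_group_pair; auto].
- by move=> [x y] [x' y'] [/inje -> /inje' ->].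
- move=> [x y]; split=> /= [[/ex0[u <-] /ex0'[v <-]]|[[u v] [<- <-]]].
    by exists (u, v).
  by rewrite (exact_at_comp0 _ ex0) (exact_at_comp0 _ ex0').
- move=> [x y]; split=> /= [[/ex[u <-] /ex'[v <-]]|[[u v] [<- <-]]].
    by exists (u, v).
  by rewrite (exact_at_comp0 _ (ex _)) (exact_at_comp0 _ (ex' _)).
Qed.

Fact fun_map_linear (T : Type) X Y (f : {linear X -> Y}) :
  linear (fun (u : T -> X) t => f (u t)).
Proof. by move=> a u v; apply/funext => t; apply: linearP. Qed.

(** Powers are exact by choice, and maps into a power of an injective module extend coordinatewise.
    An infinite [T] serves the swindle below, a finite one [id_le_restr_regular]. *)
Lemma id_le_fun (T : Type) X n : id_le X n -> id_le (T -> X : lmodType R) n.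
Proof.
apply: (@id_le_functor R R (fun X => T -> X : lmodType R)
  (fun X Y f => lin (@fun_map_linear T X Y f))).
- by move=> {}X X0 u; apply/funext => t; apply: X0.
- move=> U V W f g fg u; split=> [gu0|[v <-]]; last first.
    by apply/funext => t; apply: exact_at_comp0 fg.
  have /choice[v vE] t : exists v, f v = u t.
    by apply/fg; exact (congr1 (fun w : T -> W => w t) gu0).
  by exists v; apply/funext.
- move=> U V f injf u v /= fuv; apply/funext => t.
  by apply: injf; have := congr1 (@^~ t) fuv.
- move=> I injI U V g f injg.
  have flin t : linear (fun u => f u t) by move=> a u v; rewrite linearP.
  have /choice[h hE] t := injI _ _ g (lin (flin t)) injg.
  have hlin : linear (fun v t => h t v).
    by move=> a u v; apply/funext => t; apply: linearP.
  by exists (lin hlin) => x; apply/funext => t; apply: hE.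
Qed.

(* An Eilenberg swindle: a direct summand [M] of [X] is the kernel of a *)
(* surjective endomorphism of [X^nat], which replaces the comparison of *)
(* injective resolutions at the price of one extra degree. *)
Lemma id_le_summand M X n (s : {linear M -> X}) (p : {linear X -> M}) :
  (forall m, p (s m) = m) -> id_le X n -> id_le M n.+1.
Proof.
move=> ps idX.
have ilin : linear (fun m (_ : nat) => s m).
  by move=> a u v; apply/funext => j; apply: linearP.
have qlin : linear (fun (u : nat -> X) j => u j - s (p (u j.+1))).
  move=> a u v; apply/funext => j.
  by rewrite /= !linearP scalerDr addrACA.
apply: (id_le_cone (i := lin ilin) (p := lin qlin)).
- by move=> m m' /(congr1 (@^~ 0%N)) /= /(congr1 p); rewrite !ps.
- move=> u; split=> [qu0|[m <-]]; last first.
    by apply/funext => j; rewrite /= ps subrr.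
  (* As [s \o p] is idempotent, this equation forces [u] to be constant, with value in the image of
     [s]. *)
  have uE j : u j = s (p (u j.+1)).
    apply/eqP; rewrite -subr_eq0; apply/eqP.
    exact (congr1 (fun w : nat -> X => w j) qu0).
  have uS j : u j = u j.+1 by rewrite uE [in RHS]uE uE ps -uE.
  exists (p (u 1%N)); apply/funext => j /=; rewrite -uE.
  by elim: j => // j ->; rewrite uS.
(* Write [E] for [s \o p]. The equation [v j - E (v j.+1) = y j] forces the component of [v j] in
   the kernel of [E] to be [y j - e j]; the component in the image solves a telescoping recursion,
   started at 0. *)
- move=> y; pose e j := s (p (y j)).
  exists (fun j => y j - e j - \sum_(i < j) e i); apply/funext => j /=.
  have eE i : s (p (e i)) = e i by rewrite /e ps.
  have -> : s (p (y j.+1 - e j.+1 - \sum_(i < j.+1) e i)) =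
      - \sum_(i < j.+1) e i.
    have eS : s (p (\sum_(i < j.+1) e i)) = \sum_(i < j.+1) e i.
      by rewrite !linear_sum; apply: eq_bigr => i _; apply: eE.
    rewrite (linearB p) (linearB s) eS (linearB p) (linearB s) eE.
    by rewrite subrr add0r.
  by rewrite opprK big_ord_recr /= addrA addrNK subrK.
- exact: id_le_fun.
- exact: id_le_fun.
Qed.

End DimensionLemmas.

(** * Corner functors *)

(* A multiplicative, not necessarily unital map [rho : S -> M_J(R)] turns an *)
(* R-module [X] into the S-module [rho(1) X^J].  Tensoring with, and taking *)
(* homomorphisms from, a finitely generated projective bimodule are of this *)
(* form, with [rho] read off a dual basis. *)
Record corner_rep (R S : pzRingType) (J : finType) := CornerRep {
  crep :> S -> J -> J -> R;
  crepD : forall s t i j, crep (s + t) i j = crep s i j + crep t i j;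
  crepM : forall s t i k, crep (s * t) i k = \sum_j crep s i j * crep t j k
}.

Section Corner.
Variables (R S : pzRingType) (J : finType) (rho : corner_rep R S J).
Variable X : lmodType R.

Definition crep_act (s : S) (x : J -> X) : J -> X :=
  fun i => \sum_j rho s i j *: x j.

Lemma crep_actM s t x : crep_act s (crep_act t x) = crep_act (s * t) x.
Proof.
apply/funext => i; rewrite /crep_act.
under eq_bigr do rewrite scaler_sumr.
rewrite exchange_big; apply: eq_bigr => k _.
by rewrite crepM scaler_suml; apply: eq_bigr => j _; rewrite scalerA.
Qed.

Lemma crep_actDr s x y : crep_act s (x + y) = crep_act s x + crep_act s y.
Proof.
apply/funext => i; rewrite !fctE /crep_act -big_split /=.
by apply: eq_bigr => j _; rewrite scalerDr.
Qed.

Lemma crep_actDl s t x : crep_act (s + t) x = crep_act s x + crep_act t x.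
Proof.
apply/funext => i; rewrite !fctE /crep_act -big_split /=.
by apply: eq_bigr => j _; rewrite crepD scalerDl.
Qed.

Lemma crep_actN s x : crep_act s (- x) = - crep_act s x.
Proof.
apply/funext => i; rewrite !fctE /crep_act -sumrN.
by apply: eq_bigr => j _; rewrite scalerN.
Qed.

Lemma crep_act0 s : crep_act s 0 = 0.
Proof.
by apply/funext => i; rewrite /crep_act big1 // => j _; exact: scaler0.
Qed.

(** By [crepM] the action of 1 is idempotent, so its fixed points are its image, and on them 1 acts
    as the identity. *)
Definition corner_pred : {pred J -> X} := fun x => `[< crep_act 1 x = x >].

Fact corner_pred_closed : zmod_closed corner_pred.
Proof.
split=> [|x y /asboolP xE /asboolP yE]; apply/asboolP; first exact: crep_act0.
by rewrite crep_actDr crep_actN xE yE.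
Qed.

HB.instance Definition _ := GRing.isZmodClosed.Build (J -> X) corner_pred
  corner_pred_closed.

Record corner := Corner { corner_val : J -> X; _ : corner_val \in corner_pred }.

HB.instance Definition _ := [isSub for corner_val].
HB.instance Definition _ := [Choice of corner by <:].
HB.instance Definition _ := [SubChoice_isSubZmodule of corner by <:].

Lemma cornerP (x : corner) : crep_act 1 (corner_val x) = corner_val x.
Proof. by apply/asboolP; case: x. Qed.

Lemma corner_inj (x y : corner) : corner_val x =1 corner_val y -> x = y.
Proof. by move=> /funext; apply: val_inj. Qed.

Fact corner_act_subproof s x : crep_act s x \in corner_pred.
Proof. by apply/asboolP; rewrite crep_actM mul1r. Qed.

Definition corner_act s x : corner := Corner (corner_act_subproof s x).

Let scale s (x : corner) : corner := corner_act s (corner_val x).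

Fact corner_scalerA s t x : scale s (scale t x) = scale (s * t) x.
Proof. by apply: val_inj; apply: crep_actM. Qed.
Fact corner_scale1r : left_id 1 scale.
Proof. by move=> x; apply: val_inj; apply: cornerP. Qed.
Fact corner_scalerDr : right_distributive scale +%R.
Proof. by move=> s x y; apply: val_inj; apply: crep_actDr. Qed.
Fact corner_scalerDl x : {morph scale^~ x : s t / s + t}.
Proof. by move=> s t; apply: val_inj; apply: crep_actDl. Qed.

HB.instance Definition _ := GRing.Zmodule_isLmodule.Build S corner
  corner_scalerA corner_scale1r corner_scalerDr corner_scalerDl.

Lemma corner_valD (x y : corner) i :
  corner_val (x + y) i = corner_val x i + corner_val y i.
Proof. by []. Qed.

Lemma corner_valZ s (x : corner) i :
  corner_val (s *: x) i = \sum_j rho s i j *: corner_val x j.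
Proof. by []. Qed.

End Corner.

Arguments corner_pred {R S J} rho X.

Section CornerMap.
Variables (R S : pzRingType) (J : finType) (rho : corner_rep R S J).
Implicit Types X Y Z : lmodType R.

Lemma crep_act_map X Y (f : {linear X -> Y}) s (x : J -> X) :
  crep_act rho s (fun i => f (x i)) = (fun i => f (crep_act rho s x i)).
Proof.
apply/funext => i; rewrite /crep_act linear_sum.
by apply: eq_bigr => j _; rewrite linearZ.
Qed.

Fact corner_map_subproof X Y (f : {linear X -> Y}) (x : corner rho X) :
  (fun i => f (corner_val x i)) \in corner_pred rho Y.
Proof. by apply/asboolP; rewrite crep_act_map cornerP. Qed.

Definition corner_map_fun X Y (f : {linear X -> Y}) (x : corner rho X) :
  corner rho Y := Corner (corner_map_subproof f x).

Fact corner_map_linear X Y (f : {linear X -> Y}) : linear (corner_map_fun f).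
Proof.
move=> s x y; apply: corner_inj => i.
rewrite corner_valD corner_valZ; change (f (corner_val (s *: x + y) i) =
  \sum_j rho s i j *: f (corner_val x j) + f (corner_val y i)).
rewrite corner_valD corner_valZ linearD linear_sum; congr (_ + _).
by apply: eq_bigr => j _; rewrite linearZ.
Qed.

Definition corner_map X Y (f : {linear X -> Y}) :
  {linear corner rho X -> corner rho Y} := lin (corner_map_linear f).

Lemma corner_zero X : zero_group X -> zero_group (corner rho X).
Proof. by move=> X0 x; apply: corner_inj => i; apply: X0. Qed.

(** Preimages chosen coordinatewise need not be fixed by [rho(1)]; applying [rho(1)] repairs this
    and keeps their image, which is already fixed. Exactness of corners rests on this. *)
Lemma corner_image X Y (f : {linear X -> Y}) (y : corner rho Y) :
  (forall i, exists x, f x = corner_val y i) ->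
  exists x, corner_map f x = y.
Proof.
move=> /choice[x fx]; exists (corner_act rho 1 x); apply: val_inj.
rewrite /= -crep_act_map -[RHS]cornerP.
by congr (crep_act _ _ _); apply/funext.
Qed.

Lemma corner_exact X Y Z (f : {linear X -> Y}) (g : {linear Y -> Z}) :
  exact_at f g -> exact_at (corner_map f) (corner_map g).
Proof.
move=> fg y; split=> [gy0|[x <-]]; last first.
  by apply: corner_inj => i; apply: exact_at_comp0 fg.
apply: corner_image => i; apply/fg.
exact: (congr1 (fun z => corner_val z i) gy0).
Qed.

Lemma corner_surjective X Y (f : {linear X -> Y}) :
  surjective_map f -> surjective_map (corner_map f).
Proof. by move=> surjf y; apply: corner_image => i; apply: surjf. Qed.

Lemma corner_injective X Y (f : {linear X -> Y}) :
  injective f -> injective (corner_map f).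
Proof.
move=> injf x y fxy; apply: corner_inj => i; apply: injf.
exact: (congr1 (fun z => corner_val z i) fxy).
Qed.

Lemma pd_le_corner X n :
  (forall P : lmodType R, projective P -> projective (corner rho P)) ->
  pd_le X n -> pd_le (corner rho X) n.
Proof.
apply: (@pd_le_functor R S (fun X => corner rho X) corner_map).
- exact: corner_zero.
- exact: corner_exact.
- exact: corner_surjective.
Qed.

Lemma id_le_corner X n :
  (forall I : lmodType R, injective_mod I -> injective_mod (corner rho I)) ->
  id_le X n -> id_le (corner rho X) n.
Proof.
apply: (@id_le_functor R S (fun X => corner rho X) corner_map).
- exact: corner_zero.
- exact: corner_exact.
- exact: corner_injective.
Qed.

End CornerMap.

(** * Tensor products and homomorphisms through dual bases *)

Section AdditiveMaps.
Variables (U V : zmodType) (f : U -> V).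
Hypothesis fD : {morph f : x y / x + y}.

Lemma morphD0 : f 0 = 0.
Proof. by apply: (addrI (f 0)); rewrite -fD !addr0. Qed.

Lemma morphD_sum (J : finType) (F : J -> U) : f (\sum_j F j) = \sum_j f (F j).
Proof. exact: (big_morph f fD morphD0). Qed.

Lemma morphDB x y : f (x - y) = f x - f y.
Proof. by apply: (addIr (f y)); rewrite -fD !subrK. Qed.

End AdditiveMaps.

(* [Q] singles out a subbimodule of [L], here either [L] itself or an ideal. *)
Record rbasis (L B : pzRingType) (bL : {rmorphism B -> L}) (Q : L -> Prop)
    (J : finType) := RBasis {
  rb_elt : J -> L;
  rb_coef : J -> L -> B;
  rb_in : forall j, Q (rb_elt j);
  rb_coefD : forall j, {morph rb_coef j : x y / x + y};
  rb_coefM : forall j x b, rb_coef j (x * bL b) = rb_coef j x * b;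
  rb_sum : forall x, Q x -> \sum_j rb_elt j * bL (rb_coef j x) = x
}.

Record lbasis (L B : pzRingType) (bL : {rmorphism B -> L}) (Q : L -> Prop)
    (J : finType) := LBasis {
  lb_elt : J -> L;
  lb_coef : J -> L -> B;
  lb_in : forall j, Q (lb_elt j);
  lb_coefD : forall j, {morph lb_coef j : x y / x + y};
  lb_coefM : forall j b x, lb_coef j (bL b * x) = b * lb_coef j x;
  lb_sum : forall x, Q x -> \sum_j bL (lb_coef j x) * lb_elt j = x
}.

Section TensorCorner.
Variables (L S B : pzRingType) (sL : {rmorphism S -> L}).
Variables (bL : {rmorphism B -> L}) (Q : L -> Prop) (J : finType).
Variable rb : rbasis bL Q J.
Hypothesis Qs : forall s x, Q x -> Q (sL s * x).

(** The matrix of left multiplication by [sL s] on [Q] in the dual basis. Its corner is [Q (x)_B X],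
    a vector [t] standing for the sum of the [rb_elt rb j (x) t j]. *)
Definition tens_crep (s : S) (i j : J) : B := rb_coef rb i (sL s * rb_elt rb j).

Fact tens_crepD s t i j :
  tens_crep (s + t) i j = tens_crep s i j + tens_crep t i j.
Proof. by rewrite /tens_crep rmorphD mulrDl rb_coefD. Qed.

Fact tens_crepM s t i k :
  tens_crep (s * t) i k = \sum_j tens_crep s i j * tens_crep t j k.
Proof.
rewrite /tens_crep rmorphM -mulrA.
rewrite -[in LHS](rb_sum rb (Qs t (rb_in rb k))) mulr_sumr.
rewrite (morphD_sum (rb_coefD rb i)).
by apply: eq_bigr => j _; rewrite mulrA rb_coefM.
Qed.

Definition tens_rep : corner_rep B S J := CornerRep tens_crepD tens_crepM.

Section Pure.
Variable X : lmodType B.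
Local Notation LX := (corner tens_rep X).

(* The pure tensor [l (x) x]; for [l] outside [Q] this is a junk value. *)
Definition tpure (l : L) (x : X) : LX :=
  corner_act tens_rep 1 (fun i => rb_coef rb i l *: x).

Lemma tpureE l x i : Q l -> corner_val (tpure l x) i = rb_coef rb i l *: x.
Proof.
move=> Ql; rewrite /tpure /= /crep_act /= /tens_crep.
under eq_bigr do rewrite rmorph1 mul1r scalerA -rb_coefM.
by rewrite -scaler_suml -(morphD_sum (rb_coefD rb i)) rb_sum.
Qed.

Lemma tpureDl x : {morph tpure^~ x : l l' / l + l'}.
Proof.
move=> l l'; apply: val_inj; rewrite /= -crep_actDr; congr crep_act.
by apply/funext => i; rewrite rb_coefD scalerDl.
Qed.

Lemma tpureDr l : {morph tpure l : x y / x + y}.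
Proof.
move=> x y; apply: val_inj; rewrite /= -crep_actDr; congr crep_act.
by apply/funext => i; rewrite scalerDr.
Qed.

Lemma tpure_balanced l b x : tpure (l * bL b) x = tpure l (b *: x).
Proof.
apply: val_inj; rewrite /=; congr crep_act.
by apply/funext => i; rewrite rb_coefM scalerA.
Qed.

Lemma tpureZ s l x : Q l -> s *: tpure l x = tpure (sL s * l) x.
Proof.
move=> Ql; apply: corner_inj => i; rewrite corner_valZ tpureE; last exact: Qs.
under eq_bigr do rewrite tpureE // scalerA /= /tens_crep -rb_coefM.
rewrite -scaler_suml -(morphD_sum (rb_coefD rb i)).
by under eq_bigr do rewrite -mulrA; rewrite -mulr_sumr rb_sum.
Qed.

Lemma tens_sum (t : LX) : \sum_j tpure (rb_elt rb j) (corner_val t j) = t.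
Proof.
apply: corner_inj => i.
rewrite (morphD_sum (fun x y => corner_valD x y i)) -[in RHS]cornerP.
apply: eq_bigr => j _; rewrite tpureE; last exact: rb_in.
by rewrite /= /tens_crep rmorph1 mul1r.
Qed.

Lemma tens_ind (P : LX -> Prop) :
  P 0 -> (forall t u, P t -> P u -> P (t + u)) ->
  (forall l x, Q l -> P (tpure l x)) -> forall t, P t.
Proof.
move=> P0 PD Ppure t; rewrite -(tens_sum t).
by apply: (big_ind P) => // j _; apply: Ppure; apply: rb_in.
Qed.

Section Lift.
Variables (Y : zmodType) (beta : L -> X -> Y).
Hypothesis betaDl : forall x, {morph beta^~ x : l l' / l + l'}.
Hypothesis betaDr : forall l, {morph beta l : x y / x + y}.
Hypothesis beta_balanced :
  forall l b x, Q l -> beta (l * bL b) x = beta l (b *: x).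

(** [tens_sum] forces this value, and balancedness of [beta] makes it correct on pure tensors: this
    is the universal property of [Q (x)_B X]. *)
Definition tlift (t : LX) : Y := \sum_j beta (rb_elt rb j) (corner_val t j).

Lemma tlift_pure l x : Q l -> tlift (tpure l x) = beta l x.
Proof.
move=> Ql; rewrite /tlift.
under eq_bigr => j _ do rewrite tpureE // -(beta_balanced _ _ (rb_in rb j)).
by rewrite -(morphD_sum (betaDl x)) rb_sum.
Qed.

Lemma tliftD : {morph tlift : t u / t + u}.
Proof.
move=> t u; rewrite /tlift -big_split /=.
by apply: eq_bigr => j _; rewrite -betaDr.
Qed.

End Lift.

Lemma tens_lift (Y : lmodType S) (beta : L -> X -> Y) :
  (forall x, {morph beta^~ x : l l' / l + l'}) ->
  (forall l, {morph beta l : x y / x + y}) ->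
  (forall l b x, Q l -> beta (l * bL b) x = beta l (b *: x)) ->
  (forall s l x, Q l -> beta (sL s * l) x = s *: beta l x) ->
  exists k : {linear LX -> Y}, forall l x, Q l -> k (tpure l x) = beta l x.
Proof.
move=> betaDl betaDr beta_balanced betaZ.
have k_linear : linear (tlift beta).
  move=> s t u; rewrite tliftD //; congr (_ + _).
  rewrite -[in LHS](tens_sum t) scaler_sumr (morphD_sum (tliftD betaDr)).
  rewrite {2}/tlift scaler_sumr; apply: eq_bigr => j _.
  by rewrite tpureZ ?tlift_pure ?betaZ //; do ?apply: Qs; apply: rb_in.
by exists (lin k_linear); apply: tlift_pure.
Qed.

End Pure.

Lemma corner_map_tpure (X Y : lmodType B) (f : {linear X -> Y}) l x :
  Q l -> corner_map tens_rep f (tpure l x) = tpure l (f x).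
Proof.
move=> Ql; apply: corner_inj => i; rewrite tpureE //=.
by rewrite -linearZ; congr (f _); apply: tpureE.
Qed.

End TensorCorner.

(** * Modules of homomorphisms as corners *)

Section HomCorner.
Variables (L S B : pzRingType) (sL : {rmorphism S -> L}).
Variables (bL : {rmorphism B -> L}) (Q : L -> Prop) (J : finType).
Variable lb : lbasis bL Q J.
Hypothesis Qs : forall s x, Q x -> Q (x * sL s).

(** A homomorphism from [Q] to [X] is stored as its values on the [lb_elt lb i]. Row [i] expands
    [lb_elt lb i * sL s], because [s] acts by right multiplication on the argument. *)
Definition hom_crep (s : S) (i j : J) : B := lb_coef lb j (lb_elt lb i * sL s).

Fact hom_crepD s t i j : hom_crep (s + t) i j = hom_crep s i j + hom_crep t i j.
Proof. by rewrite /hom_crep rmorphD mulrDr lb_coefD. Qed.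

Fact hom_crepM s t i k :
  hom_crep (s * t) i k = \sum_j hom_crep s i j * hom_crep t j k.
Proof.
rewrite /hom_crep rmorphM mulrA.
rewrite -[in LHS](lb_sum lb (Qs s (lb_in lb i))) mulr_suml.
rewrite (morphD_sum (lb_coefD lb k)).
by apply: eq_bigr => j _; rewrite -mulrA lb_coefM.
Qed.

Definition hom_rep : corner_rep B S J := CornerRep hom_crepD hom_crepM.

Variable X : lmodType B.
Local Notation HX := (corner hom_rep X).

Definition heval (f : HX) (l : L) : X :=
  \sum_j lb_coef lb j l *: corner_val f j.

Lemma hevalDl f : {morph heval f : l l' / l + l'}.
Proof.
move=> l l'; rewrite /heval -big_split /=.
by apply: eq_bigr => j _; rewrite lb_coefD scalerDl.
Qed.

Lemma hevalDr l : {morph heval^~ l : f g / f + g}.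
Proof.
move=> f g; rewrite /heval -big_split /=.
by apply: eq_bigr => j _; rewrite -scalerDr.
Qed.

Lemma heval_linear f b l : heval f (bL b * l) = b *: heval f l.
Proof.
rewrite /heval scaler_sumr.
by apply: eq_bigr => j _; rewrite lb_coefM scalerA.
Qed.

Lemma heval_elt f i : heval f (lb_elt lb i) = corner_val f i.
Proof.
rewrite -[in RHS]cornerP; apply: eq_bigr => j _.
by rewrite /= /hom_crep rmorph1 mulr1.
Qed.

Lemma linear_lb_sum (h : L -> X) l :
  {morph h : x y / x + y} -> (forall b x, Q x -> h (bL b * x) = b *: h x) ->
  Q l -> h l = \sum_j lb_coef lb j l *: h (lb_elt lb j).
Proof.
move=> hD hZ Ql; rewrite -[in LHS](lb_sum lb Ql) (morphD_sum hD).
by apply: eq_bigr => j _; rewrite hZ //; apply: lb_in.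
Qed.

Lemma hevalZ s f l : Q l -> heval (s *: f) l = heval f (l * sL s).
Proof.
move=> Ql; rewrite [RHS](@linear_lb_sum (fun x => heval f (x * sL s)) l) //.
- by move=> x y; rewrite mulrDl hevalDl.
- by move=> b x _; rewrite -mulrA heval_linear.
Qed.

Lemma heval_inj f g : (forall l, Q l -> heval f l = heval g l) -> f = g.
Proof.
move=> fg; apply: corner_inj => i; rewrite -!heval_elt; apply: fg.
exact: lb_in.
Qed.

(** The projection makes this total; when [h] is additive and [B]-linear on [Q], its values already
    form a fixed vector. *)
Definition hmk (h : L -> X) : HX :=
  corner_act hom_rep 1 (fun i => h (lb_elt lb i)).

Lemma heval_hmk (h : L -> X) l :
  {morph h : x y / x + y} -> (forall b x, Q x -> h (bL b * x) = b *: h x) ->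
  Q l -> heval (hmk h) l = h l.
Proof.
move=> hD hZ Ql; rewrite [RHS](linear_lb_sum hD hZ Ql).
apply: eq_bigr => j _; congr (_ *: _).
rewrite [RHS](linear_lb_sum hD hZ (lb_in lb j)).
by apply: eq_bigr => k _; rewrite /= /hom_crep rmorph1 mulr1.
Qed.

End HomCorner.

Arguments heval_hmk {L S B sL bL Q J lb Qs X h l}.

(** * Split extensions by an ideal of tensor square zero *)

Section SplitExtension.
Variables (L B : pzRingType) (iota : {rmorphism B -> L}).
Variable pi : {rmorphism L -> B}.
Hypothesis piK : forall b, pi (iota b) = b.
Variables (J J' : finType).
Variable lb : lbasis iota (fun=> True) J.
Variable rb : rbasis iota (fun=> True) J'.

(* This says that [ker pi (x)_B ker pi] vanishes. *)
Hypothesis tens_ker0 : forall (V : zmodType) (beta : L -> L -> V),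
  (forall y, {morph beta^~ y : x x' / x + x'}) ->
  (forall x, {morph beta x : y y' / y + y'}) ->
  (forall x b y, beta (x * iota b) y = beta x (iota b * y)) ->
  forall x y, pi x = 0 -> pi y = 0 -> beta x y = 0.

Let N (x : L) : Prop := pi x = 0.
Let c (x : L) : L := x - iota (pi x).

Fact compl_in x : N (c x).
Proof. by rewrite /N /c rmorphB piK subrr. Qed.

Fact complD : {morph c : x y / x + y}.
Proof. by move=> x y; rewrite /c !rmorphD opprD addrACA. Qed.

Fact complMr x b : c (x * iota b) = c x * iota b.
Proof. by rewrite /c !rmorphM piK mulrBl. Qed.

Fact complMl b x : c (iota b * x) = iota b * c x.
Proof. by rewrite /c !rmorphM piK mulrBr. Qed.

Fact compl_id x : N x -> c x = x.
Proof. by rewrite /N /c => ->; rewrite rmorph0 subr0. Qed.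

Fact compl1 : c 1 = 0.
Proof. by rewrite /c !rmorph1 subrr. Qed.

Fact compl_split x : x = 1 * iota (pi x) + c x.
Proof. by rewrite mul1r /c addrC subrK. Qed.

Fact ker_rb_sum x :
  N x -> \sum_j c (rb_elt rb j) * iota (rb_coef rb j x) = x.
Proof.
move=> Nx; under eq_bigr do rewrite -complMr.
by rewrite -(morphD_sum complD) rb_sum // compl_id.
Qed.

(** Since [c] is [B]-linear and fixes the kernel, projecting the generators of [L] gives generators
    of the kernel with unchanged coefficients. *)
Let rbN : rbasis iota N J' := RBasis (fun j => compl_in (rb_elt rb j))
  (rb_coefD rb) (rb_coefM rb) ker_rb_sum.

Fact ker_lb_sum x :
  N x -> \sum_j iota (lb_coef lb j x) * c (lb_elt lb j) = x.
Proof.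
move=> Nx; under eq_bigr do rewrite -complMl.
by rewrite -(morphD_sum complD) lb_sum // compl_id.
Qed.

Let lbN : lbasis iota N J := LBasis (fun j => compl_in (lb_elt lb j))
  (lb_coefD lb) (lb_coefM lb) ker_lb_sum.

Fact kerMl b x : N x -> N (iota b * x).
Proof. by rewrite /N rmorphM => ->; rewrite mulr0. Qed.

Fact kerMr b x : N x -> N (x * iota b).
Proof. by rewrite /N rmorphM => ->; rewrite mul0r. Qed.

(** With [K = ker pi], the four corners are [L (x)_B -] and [Hom_B(L, -)] over [L], and [K (x)_B -]
    and [Hom_B(K, -)] over [B]. *)
Let ind_rep := @tens_rep L L B idfun iota _ J' rb (fun _ _ _ => I).
Let ntens_rep := @tens_rep L B B iota iota N J' rbN kerMl.
Let coind_rep := @hom_rep L L B idfun iota _ J lb (fun _ _ _ => I).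
Let nhom_rep := @hom_rep L B B iota iota N J lbN kerMr.

Local Notation ind X := (corner ind_rep X).
Local Notation ntens X := (corner ntens_rep X).
Local Notation coind X := (corner coind_rep X).
Local Notation nhom X := (corner nhom_rep X).

Local Notation tpL := (@tpure L L B idfun iota _ J' rb (fun _ _ _ => I) _).
Local Notation tpN := (@tpure L B B iota iota N J' rbN kerMl _).
Local Notation evL := (@heval L L B idfun iota _ J lb (fun _ _ _ => I) _).
Local Notation evN := (@heval L B B iota iota N J lbN kerMr _).
Local Notation mkL := (@hmk L L B idfun iota _ J lb (fun _ _ _ => I) _).
Local Notation mkN := (@hmk L B B iota iota N J lbN kerMr _).

(** * Induction and projective dimension *)

Lemma ind_projective (P : lmodType B) : projective P -> projective (ind P).
Proof.
move=> projP U V g f surjg.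
(* By adjunction [f] is determined by its values on the [1 (x) x]; these are lifted over [B] and
   extended [L]-linearly. *)
have f1lin : linear (fun x => f (tpL 1 x) : restr V iota).
  move=> b x y; rewrite tpureDr linearD; congr (_ + _).
  by rewrite restr_scaleE -linearZ tpureZ //= mulr1 -tpure_balanced mul1r.
have [h hE] := projP _ _ (restr_map iota g) (lin f1lin) surjg.
have [||||k kE] := @tens_lift _ _ _ idfun _ _ _ rb (fun _ _ _ => I) P U
  (fun l x => l *: (h x : U)).
- by move=> x l l'; rewrite scalerDl.
- by move=> l x y; rewrite linearD scalerDr.
- by move=> l b x _; rewrite linearZ /= restr_scaleE scalerA.
- by move=> s l x _; rewrite scalerA.
exists k; apply: tens_ind => [|t u gt gu|l x _].
- by rewrite !linear0.
- by rewrite !linearD gt gu.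
- rewrite kE // linearZ -[l in RHS]mulr1 -(tpureZ (sL := idfun)) // linearZ.
  by congr (_ *: _); apply: hE.
Qed.

Section Induction.
Variable M : lmodType L.
Local Notation Mb := (restr M iota).

(** The tensors [n (x) (n' (x) m)] come from [K (x)_B K], which vanishes. *)
Lemma tpure_ntens0 n (t : ntens Mb) : N n -> tpL n t = 0.
Proof.
move=> Nn; move: t; apply: tens_ind => [|t u nt nu|n' m Nn'].
- exact: morphD0 (tpureDr _ _ _).
- by rewrite tpureDr nt nu addr0.
- rewrite -(compl_id Nn) -(compl_id Nn').
  (* [tens_ker0] asks for a pairing balanced on all of [L], while [tpN] is junk off the kernel;
     inserting [c] extends the pairing. *)
  apply: (tens_ker0 (beta := fun x y => tpL (c x) (tpN (c y) m))) => //.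
  + by move=> y x x'; rewrite complD tpureDl.
  + by move=> x y y'; rewrite complD tpureDl tpureDr.
  + move=> x b y; rewrite complMr complMl tpure_balanced tpureZ //.
    exact: compl_in.
Qed.

(** Split [l] along [L = iota B + K]: the part in [K] contributes nothing and the other moves across
    the tensor sign. *)
Lemma ind_ntens_pure (z : ind (ntens Mb)) : exists t, z = tpL 1 t.
Proof.
move: z; apply: tens_ind => [|_ _ [t ->] [u ->]|l t _].
- by exists 0; rewrite (morphD0 (tpureDr _ _ _)).
- by exists (t + u); rewrite tpureDr.
- exists (pi l *: t); rewrite [l in LHS]compl_split tpureDl tpure_balanced.
  by rewrite (tpure_ntens0 t (compl_in l)) addr0.
Qed.

Lemma pd_le_split_extension n :
  (forall X : lmodType B, pd_le X n) -> pd_le M n.+1.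
Proof.
move=> pdB.
(* [q] is the multiplication map, sending [l (x) m] to [l m]. *)
have [||||q qE] := @tens_lift _ _ _ idfun _ _ _ rb (fun _ _ _ => I) Mb M
  (fun l m => l *: (m : M)).
- by move=> x l l'; rewrite scalerDl.
- by move=> l x y; rewrite scalerDr.
- by move=> l b x _; rewrite restr_scaleE scalerA.
- by move=> s l x _; rewrite scalerA.
(* [k0] sends [n (x) m] to [n (x) m - 1 (x) n m], the typical element of the kernel of [q]. It is
   [B]-linear, and [k] is its [L]-linear extension. *)
have [||||k0 k0E] := @tens_lift _ _ _ iota _ _ _ rbN kerMl Mb
  (restr (ind Mb) iota) (fun l m => tpL l m - tpL 1 (l *: (m : M) : Mb)).
- by move=> x l l'; rewrite tpureDl scalerDl tpureDr opprD addrACA.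
- by move=> l x y; rewrite tpureDr scalerDr tpureDr opprD addrACA.
- by move=> l b x _; rewrite restr_scaleE tpure_balanced scalerA.
- move=> b l x _; rewrite restr_scaleE scalerBr !tpureZ //= mulr1.
  congr (_ - _); transitivity (tpL (1 * iota b) (l *: (x : M) : Mb)).
    by rewrite tpure_balanced restr_scaleE scalerA.
  by rewrite mul1r.
have [||||k kE] := @tens_lift _ _ _ idfun _ _ _ rb (fun _ _ _ => I) (ntens Mb)
  (ind Mb) (fun l t => l *: (k0 t : ind Mb)).
- by move=> x l l'; rewrite scalerDl.
- by move=> l x y; rewrite linearD scalerDr.
- by move=> l b x _; rewrite linearZ /= restr_scaleE scalerA.
- by move=> s l x _; rewrite scalerA.
have qk0 t : q (k0 t) = 0.
  move: t; apply: tens_ind => [|t u qt qu|l m Nl].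
  - by rewrite !linear0.
  - by rewrite !linearD qt qu addr0.
  - by rewrite k0E // linearB !qE // scale1r subrr.
(* An additive retraction of [k0]: the correction [1 (x) n m] dies because [c 1 = 0]. *)
pose theta := @tlift _ _ _ idfun _ _ _ rb (fun _ _ _ => I) Mb
  (ntens Mb) (fun l m => tpN (c l) m).
have thetaD : {morph theta : x y / x + y}.
  by apply: tliftD => l x y; rewrite tpureDr.
have thetaE l m : theta (tpL l m) = tpN (c l) m.
  apply: tlift_pure => // [x l1 l2|l1 b x _].
    by rewrite complD tpureDl.
  by rewrite complMr tpure_balanced.
have thetaK t : theta (k0 t) = t.
  move: t; apply: tens_ind => [|t u qt qu|l m Nl].
  - by rewrite linear0 (morphD0 thetaD).
  - by rewrite linearD thetaD qt qu.
  - rewrite k0E // (morphDB thetaD) !thetaE compl_id // compl1.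
    by rewrite (morphD0 (tpureDl _ _ _)) subr0.
apply: (pd_le_cone (i := k) (p := q)).
- move=> z z'; have [[t ->] [u ->]] := (ind_ntens_pure z, ind_ntens_pure z').
  by rewrite !kE // !scale1r => k0tu; rewrite -(thetaK t) -(thetaK u) k0tu.
- move=> t; split=> [|[z <-]]; last first.
    by have [u ->] := ind_ntens_pure z; rewrite kE // scale1r qk0.
  (* Modulo the image of [k0] every tensor has the form [1 (x) m], where [m] can only be [q t]. *)
  have [u tE] : exists u, t = k0 u + tpL 1 (q t : Mb).
    move: t; apply: tens_ind => [|t u [t' tE] [u' uE]|l m _].
    - by exists 0; rewrite !linear0 (morphD0 (tpureDr _ _ _)) addr0.
    - exists (t' + u'); rewrite [in LHS]tE [in LHS]uE !linearD tpureDr.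
      by rewrite addrACA.
    - exists (tpN (c l) m); rewrite k0E; last exact: compl_in.
      have -> : tpL 1 (q (tpL l m) : Mb) =
          tpL 1 (pi l *: m) + tpL 1 (c l *: (m : M) : Mb).
        by rewrite -tpureDr qE // [l in LHS]compl_split mul1r scalerDl.
      rewrite addrCA subrK.
      by rewrite [l in LHS]compl_split tpureDl tpure_balanced.
  move=> qt0; exists (tpL 1 u); rewrite kE // scale1r tE qt0.
  by rewrite (morphD0 (tpureDr _ _ _)) addr0.
- by move=> m; exists (tpL 1 (m : Mb)); rewrite qE // scale1r.
- exact: pd_le_corner ind_projective _.
- exact: pd_le_corner ind_projective _.
Qed.

End Induction.

(** * Coinduction and injective dimension *)

Lemma coind_injective (E : lmodType B) :
  injective_mod E -> injective_mod (coind E).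
Proof.
move=> injE U V g f injg.
(* By adjunction [f] corresponds to evaluation at 1; an extension [h] of it over [B] yields the map
   taking [v] to the homomorphism [l |-> h (l v)]. *)
have f1lin : linear (fun u : restr U iota => evL (f u) 1).
  move=> b x y; rewrite restr_scaleE linearD linearZ hevalDr /=.
  by rewrite hevalZ //= mul1r -[iota b]mulr1 heval_linear.
have [h hE] := injE _ _ (restr_map iota g) (lin f1lin) injg.
pose k v l := h (l *: (v : V) : restr V iota).
have kD v : {morph k v : x y / x + y}.
  by move=> x y; rewrite /k scalerDl linearD.
have kZ v b x : True -> k v (iota b * x) = b *: k v x.
  by move=> _; rewrite /k -scalerA -linearZ.
have klin : linear (fun v => mkL (k v)).
  move=> s v w; apply: heval_inj => l _; rewrite hevalDr hevalZ //.
  by rewrite !(heval_hmk (kD _) (kZ _)) // /k scalerDr linearD scalerA.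
exists (lin klin) => u; apply: heval_inj => l _.
rewrite (heval_hmk (kD _) (kZ _)) // /k -linearZ; have /= -> := hE (l *: u).
by rewrite linearZ /= hevalZ //= mul1r.
Qed.

(** By Hom-tensor adjunction [f] becomes a map from [K (x)_B U] to [E]. It extends along
    [K (x)_B g], which is injective because corners preserve injections. *)
Lemma nhom_injective (E : lmodType B) :
  injective_mod E -> injective_mod (nhom E).
Proof.
move=> injE U V g f injg.
have [||||f1 f1E] := @tens_lift _ _ _ iota _ _ _ rbN kerMl U E
  (fun l u => evN (f u) l).
- by move=> x l l'; rewrite hevalDl.
- by move=> l x y; rewrite linearD hevalDr.
- by move=> l b x Nl; rewrite linearZ /= hevalZ.
- by move=> b l x _; rewrite heval_linear.
have [h hE] := injE _ _ (corner_map ntens_rep g) f1 (corner_injective injg).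
pose k v l := h (tpN l v).
have kD v : {morph k v : x y / x + y}.
  by move=> x y; rewrite /k tpureDl linearD.
have kZ v b x : N x -> k v (iota b * x) = b *: k v x.
  by move=> Nx; rewrite /k -linearZ tpureZ.
have klin : linear (fun v => mkN (k v)).
  move=> b v w; apply: heval_inj => l Nl; rewrite hevalDr hevalZ //.
  rewrite !(heval_hmk (kD _) (kZ _)) //; last exact: kerMr.
  by rewrite /k tpureDr linearD tpure_balanced.
exists (lin klin) => u; apply: heval_inj => l Nl.
by rewrite (heval_hmk (kD _) (kZ _)) // /k -corner_map_tpure // hE f1E.
Qed.

(** On [K], [g] is a homomorphism to [Hom_B(K, X)], that is, a balanced pairing on [K] with itself,
    hence zero. *)
Lemma heval_nhom0 (X : lmodType B) (g : coind (nhom X)) n :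
  N n -> evL g n = 0.
Proof.
move=> Nn; apply: heval_inj => x Nx.
rewrite (morphD0 (hevalDr x)) -(compl_id Nx).
apply: (tens_ker0 (beta := fun x y => evN (evL g y) (c x))) => //.
- by move=> y x1 x2; rewrite complD hevalDl.
- by move=> x1 y y'; rewrite hevalDl hevalDr.
- move=> x1 b y; rewrite heval_linear complMr hevalZ //.
  exact: compl_in.
Qed.

Lemma coind_nhom_inj (X : lmodType B) (g g' : coind (nhom X)) :
  evL g 1 = evL g' 1 -> g = g'.
Proof.
have evE (g0 : coind (nhom X)) l : evL g0 l = pi l *: evL g0 1.
  rewrite [l in LHS]compl_split mul1r -[iota _]mulr1 hevalDl heval_linear.
  by rewrite (heval_nhom0 g0 (compl_in l)) addr0.
by move=> gg'; apply: heval_inj => l _; rewrite (evE g) (evE g') gg'.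
Qed.

Lemma id_le_split_extension (M : lmodType L) n :
  id_le (restr M iota) n -> id_le M n.+1.
Proof.
pose Mb := restr M iota; move=> idM.
pose eta m l : Mb := l *: (m : M).
have etaD m : {morph eta m : x y / x + y}.
  by move=> x y; rewrite /eta scalerDl.
have etaZ m b x : True -> eta m (iota b * x) = b *: eta m x.
  by rewrite /eta -scalerA.
have eta_lin : linear (fun m => mkL (eta m)).
  move=> s m m'; apply: heval_inj => l _; rewrite hevalDr hevalZ //.
  by rewrite !(heval_hmk (etaD _) (etaZ _)) // /eta scalerDr scalerA.
(* [d0 f] measures on [K] how far [f] is from [eta (evL f 1)], the only [eta m] it could equal. *)
pose d0 (f : coind Mb) x : Mb := evL f x - x *: (evL f 1 : M).
have d0D f : {morph d0 f : x y / x + y}.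
  by move=> x y; rewrite /d0 hevalDl scalerDl opprD addrACA.
have d0Z f b x : N x -> d0 f (iota b * x) = b *: d0 f x.
  move=> _; rewrite /d0 heval_linear scalerBr; congr (_ - _).
  by rewrite restr_scaleE scalerA.
pose D0 f : nhom Mb := mkN (d0 f).
have D0D : {morph D0 : f f' / f + f'}.
  move=> f f'; apply: heval_inj => x Nx; rewrite hevalDr.
  rewrite !(heval_hmk (d0D _) (d0Z _)) //.
  by rewrite /d0 !hevalDr scalerDr opprD addrACA.
have D0Z b f : D0 (iota b *: f) = b *: D0 f.
  apply: heval_inj => x Nx; rewrite hevalZ //.
  rewrite !(heval_hmk (d0D _) (d0Z _)) //; last exact: kerMr.
  rewrite /d0 !hevalZ //= mul1r -[in X in _ - X](mulr1 (iota b)) heval_linear.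
  by rewrite restr_scaleE scalerA.
(* [D0] is [B]-linear; this is the [L]-linear map that corresponds to it under the coinduction
   adjunction. *)
pose d (f : coind Mb) l := D0 (l *: f).
have dD f : {morph d f : x y / x + y} by move=> x y; rewrite /d scalerDl D0D.
have dZ f b x : True -> d f (iota b * x) = b *: d f x.
  by rewrite /d -scalerA D0Z.
have d_lin : linear (fun f => mkL (d f)).
  move=> s f f'; apply: heval_inj => l _; rewrite hevalDr hevalZ //.
  by rewrite !(heval_hmk (dD _) (dZ _)) // /d scalerDr scalerA D0D.
apply: (id_le_cone (i := lin eta_lin) (p := lin d_lin)).
- move=> m m' /(congr1 (fun f => evL f 1)).
  by rewrite /= !(heval_hmk (etaD _) (etaZ _)) // /eta !scale1r.
- move=> f; split=> [df0|[m <-]] /=; last first.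
    apply: heval_inj => l _.
    rewrite (heval_hmk (dD _) (dZ _)) // (morphD0 (hevalDr l)).
    apply: heval_inj => x Nx.
    rewrite (heval_hmk (d0D _) (d0Z _)) // (morphD0 (hevalDr x)).
    rewrite /d0 !hevalZ // !(heval_hmk (etaD _) (etaZ _)) // /eta /=.
    by rewrite mul1r scalerA subrr.
  exists (evL f 1); apply: heval_inj => l _.
  rewrite (heval_hmk (etaD _) (etaZ _)) // /eta.
  have fN x : N x -> evL f x = x *: (evL f 1 : M).
    move=> Nx; have := congr1 (fun g => evN (evL g 1) x) df0.
    rewrite /= (heval_hmk (dD _) (dZ _)) // (heval_hmk (d0D _) (d0Z _)) //.
    rewrite (morphD0 (hevalDr 1)) (morphD0 (hevalDr x)).
    by rewrite scale1r => /eqP; rewrite subr_eq0 => /eqP.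
  rewrite [l in RHS]compl_split [in RHS]hevalDl (fN _ (compl_in l)).
  rewrite mul1r -[iota _ in RHS]mulr1 heval_linear restr_scaleE.
  by rewrite [l in LHS]compl_split mul1r scalerDl.
(* Extending the value of [g] at 1 by zero on the image of [iota] gives [h 1 = 0], so the correction
   in [d0] disappears; agreement at 1 suffices by [coind_nhom_inj]. *)
- move=> g; pose h l := evN (evL g 1) (c l).
  have hD : {morph h : x y / x + y} by move=> x y; rewrite /h complD hevalDl.
  have hZ b x : True -> h (iota b * x) = b *: h x.
    by rewrite /h complMl heval_linear.
  exists (mkL h); apply: coind_nhom_inj.
  rewrite (heval_hmk (dD _) (dZ _)) // /d scale1r.
  apply: heval_inj => x Nx; rewrite (heval_hmk (d0D _) (d0Z _)) // /d0.
  rewrite !(heval_hmk hD hZ) // /h compl1.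
  by rewrite (morphD0 (hevalDl _)) scaler0 subr0 compl_id.
- apply: id_le_corner coind_injective _; apply: id_le_corner => //.
  exact: nhom_injective.
- exact: id_le_corner coind_injective _.
Qed.

(** The left dual basis makes [L] a direct summand of [B^J] over [B]; the extra degree is that of
    [id_le_summand]. *)
Lemma id_le_restr_regular n :
  id_le (B^o : lmodType B) n -> id_le (restr (L^o : lmodType L) iota) n.+1.
Proof.
move=> idB; pose Lb := restr (L^o : lmodType L) iota.
have slin : linear (fun (x : Lb) j => lb_coef lb j x : B^o).
  move=> b x y; apply/funext => j.
  by rewrite restr_scaleE lb_coefD lb_coefM.
have plin : linear (fun y : J -> B^o => \sum_j iota (y j) * lb_elt lb j : Lb).
  move=> b x y; rewrite restr_scaleE scaler_sumr -big_split /=.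
  apply: eq_bigr => j _; rewrite !fctE rmorphD mulrDl; congr (_ + _).
  by rewrite rmorphM -mulrA.
apply: (id_le_summand (s := lin slin) (p := lin plin)).
  by move=> x; exact: (lb_sum lb (x := x) I).
exact: id_le_fun.
Qed.

Theorem finite_gldim_split_extension : finite_gldim B -> finite_gldim L.
Proof. by move=> [n gB]; exists n.+1 => M; apply: pd_le_split_extension. Qed.

Theorem finite_id_split_extension :
  finite_id (B^o : lmodType B) -> finite_id (L^o : lmodType L).
Proof.
(* One degree is for the summand [L] of [B^J], the other for the coinduction sequence. *)
move=> [n idB]; exists n.+2; apply: id_le_split_extension.
exact: id_le_restr_regular.
Qed.

End SplitExtension.

(** * Direct factors of rings *)

Section Factor.
Variables (A B : pzRingType) (d : {rmorphism A -> B}).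

(* The central idempotent [e] cuts out a factor of [B] which [p] and [d] *)
(* identify with [A]. *)
Definition ring_factor (p : {rmorphism B -> A}) (e : B) : Prop :=
  [/\ forall a, p (d a) = a, p e = 1, forall b, e * b = b * e
    & forall b, e * b = e * d (p b)].

Section OneFactor.
Variables (p : {rmorphism B -> A}) (e : B).
Hypothesis fac : ring_factor p e.

(** A lift [h] over [A] is linear along [d] only; multiplying by the central [e] makes it
    [B]-linear, as [e * b = e * d (p b)], and still a lift, as [p e = 1]. *)
Lemma projective_factor (P : lmodType A) :
  projective P -> projective (restr P p).
Proof.
have [pd pe ec ed] := fac; move=> projP U V g f surjg.
have flin : linear (fun x : P => f (x : restr P p) : restr V d).
  move=> a x y; rewrite -[a in LHS]pd.
  by have := linearP f (d a) (x : restr P p) y.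
have [h hE] := projP _ _ (restr_map d g) (lin flin) surjg.
have klin : linear (fun x : restr P p => e *: (h (x : P) : U)).
  move=> b x y; rewrite restr_scaleE linearD linearZ /= restr_scaleE.
  by rewrite scalerDr !scalerA -ed ec.
exists (lin klin) => x; rewrite /= linearZ /=; have /= -> := hE x.
by rewrite -linearZ restr_scaleE pe scale1r.
Qed.

Lemma injective_factor (E : lmodType A) :
  injective_mod E -> injective_mod (restr E p).
Proof.
have [pd pe ec ed] := fac; move=> injE U V g f injg.
have flin : linear (fun u : restr U d => f (u : U) : E).
  by move=> a x y; rewrite restr_scaleE linearP restr_scaleE pd.
have [h hE] := injE _ _ (restr_map d g) (lin flin) injg.
have klin : linear (fun v : V => h (e *: v : restr V d) : restr E p).
  move=> b x y; rewrite scalerDr linearD; congr (_ + _).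
  have -> : e *: (b *: x) = d (p b) *: (e *: x) by rewrite !scalerA ed ec.
  exact: (linearZ_LR h (p b) (e *: x : restr V d)).
exists (lin klin) => u; rewrite /= -linearZ; have /= -> := hE (e *: u).
by rewrite linearZ /= restr_scaleE pe scale1r.
Qed.

Lemma pd_le_factor (X : lmodType A) n : pd_le X n -> pd_le (restr X p) n.
Proof.
apply: (@pd_le_functor A B (fun X => restr X p)
  (fun X Y f => restr_map p f)) => //.
exact: projective_factor.
Qed.

Lemma id_le_factor (X : lmodType A) n : id_le X n -> id_le (restr X p) n.
Proof.
apply: (@id_le_functor A B (fun X => restr X p)
  (fun X Y f => restr_map p f)) => //.
exact: injective_factor.
Qed.

Section FactorModule.
Variable M : lmodType B.
Let fixed (x : restr M d) : Prop := e *: (x : M) = x.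

Fact factor_mod0 : fixed 0.
Proof. exact: scaler0. Qed.

Fact factor_modL a x y : fixed x -> fixed y -> fixed (a *: x + y).
Proof.
have [_ _ ec _] := fac; rewrite /fixed restr_scaleE => ex ey.
by rewrite scalerDr ey scalerA ec -scalerA ex.
Qed.

Definition factor_mod : lmodType A := submod fixed factor_mod0 factor_modL.

End FactorModule.
End OneFactor.

Section TwoFactors.
Variables (p1 p2 : {rmorphism B -> A}) (e1 e2 : B).
Hypotheses (fac1 : ring_factor p1 e1) (fac2 : ring_factor p2 e2).
Hypothesis e12 : e1 + e2 = 1.

Fact factor_proj12 : p1 e2 = 0.
Proof.
have [_ pe _ _] := fac1.
by apply: (addrI 1); rewrite -[in LHS]pe -rmorphD e12 rmorph1 addr0.
Qed.

Fact factor_proj21 : p2 e1 = 0.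
Proof.
have [_ pe _ _] := fac2.
by apply: (addIr 1); rewrite -[in LHS]pe -rmorphD e12 rmorph1 add0r.
Qed.

(** [M] is the direct sum of [e1 M] and [e2 M], each an [A]-module through [d], restricted back
    along its projection. *)
Lemma finite_gldim_factors : finite_gldim A -> finite_gldim B.
Proof.
have [pd1 pe1 ec1 ed1] := fac1; have [pd2 pe2 ec2 ed2] := fac2.
move=> [n gA]; exists n => M.
pose M1 := factor_mod fac1 M; pose M2 := factor_mod fac2 M.
have e1e2 : e1 * e2 = 0 by rewrite ed1 factor_proj12 rmorph0 mulr0.
have e1e1 : e1 * e1 = e1 by rewrite ed1 pe1 rmorph1 mulr1.
have e2e2 : e2 * e2 = e2 by rewrite ed2 pe2 rmorph1 mulr1.
have E1 (x : M1) : e1 *: (submod_val x : M) = submod_val x := submodP x.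
have E2 (x : M2) : e2 *: (submod_val x : M) = submod_val x := submodP x.
have flin : linear (fun x : restr M1 p1 * restr M2 p2 =>
    (submod_val (x.1 : M1) : M) + (submod_val (x.2 : M2) : M)).
  move=> b x y; rewrite /= addrACA; congr (_ + _).
  rewrite scalerDr -[in RHS](E1 x.1) -[in RHS](E2 x.2) !scalerA.
  rewrite -ec1 -ec2 ed1 ed2 ec1 ec2 -!scalerA.
  by rewrite (E1 x.1) (E2 x.2).
apply: (pd_le_iso (f := lin flin)).
- move=> [x1 x2] [y1 y2] /= xy.
  have Z1 (z1 : M1) (z2 : M2) :
      e1 *: ((submod_val z1 : M) + (submod_val z2 : M)) = submod_val z1.
    by rewrite scalerDr E1 -E2 scalerA e1e2 scale0r addr0.
  have Z2 (z1 : M1) (z2 : M2) :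
      e2 *: ((submod_val z1 : M) + (submod_val z2 : M)) = submod_val z2.
    by rewrite scalerDr E2 -E1 scalerA -ec1 e1e2 scale0r add0r.
  have xy1 : x1 = y1 by apply: submod_inj; rewrite -(Z1 x1 x2) xy Z1.
  have xy2 : x2 = y2 by apply: submod_inj; rewrite -(Z2 x1 x2) xy Z2.
  by rewrite xy1 xy2.
- move=> m.
  have F1 : e1 *: (e1 *: m) = e1 *: m by rewrite scalerA e1e1.
  have F2 : e2 *: (e2 *: m) = e2 *: m by rewrite scalerA e2e2.
  exists (mk_submod _ _ F1 : M1, mk_submod _ _ F2 : M2).
  by rewrite /= -scalerDl e12 scale1r.
- apply: pd_le_pair; first exact: (pd_le_factor fac1).
  exact: (pd_le_factor fac2).
Qed.

Lemma finite_id_factors :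
  finite_id (A^o : lmodType A) -> finite_id (B^o : lmodType B).
Proof.
have [pd1 pe1 ec1 ed1] := fac1; have [pd2 pe2 ec2 ed2] := fac2.
move=> [n idA]; exists n.
have flin : linear (fun b : B^o => (p1 b, p2 b) :
    restr (A^o : lmodType A) p1 * restr (A^o : lmodType A) p2).
  by move=> a x y; rewrite /= !rmorphD !rmorphM.
apply: (id_le_iso (f := lin flin)).
- move=> x y [p1xy p2xy]; rewrite -[x]mul1r -[y]mul1r -e12 !mulrDl.
  by rewrite ed1 ed2 p1xy p2xy -ed1 -ed2.
- move=> [x y]; exists (e1 * d x + e2 * d y); congr (_, _).
    by rewrite rmorphD !rmorphM pe1 factor_proj12 pd1 mul1r mul0r addr0.
  by rewrite rmorphD !rmorphM pe2 factor_proj21 pd2 mul1r mul0r add0r.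
- apply: id_le_pair; first exact: (id_le_factor fac1).
  exact: (id_le_factor fac2).
Qed.

End TwoFactors.
End Factor.

(** * The converse ring *)

Section ConverseMorphism.
Variables (R S : pzRingType) (f : {rmorphism R -> S}).

Definition converse_map : R^c -> S^c := f.

Fact converse_map_zmod_morphism : zmod_morphism converse_map.
Proof. exact: (rmorphB f). Qed.

Fact converse_map_monoid_morphism : monoid_morphism converse_map.
Proof. by split=> [|x y]; [apply: (rmorph1 f) | apply: (rmorphM f)]. Qed.

HB.instance Definition _ := GRing.isZmodMorphism.Build R^c S^c converse_map
  converse_map_zmod_morphism.
HB.instance Definition _ := GRing.isMonoidMorphism.Build R^c S^c converse_map
  converse_map_monoid_morphism.

Definition converse_rmorphism : {rmorphism R^c -> S^c} := converse_map.

End ConverseMorphism.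

Lemma ring_factor_converse (A B : pzRingType) (d : {rmorphism A -> B})
    (p : {rmorphism B -> A}) (e : B) :
  ring_factor d p e ->
  ring_factor (converse_rmorphism d) (converse_rmorphism p) (e : B^c).
Proof.
move=> [pd pe ec ed]; split=> //= b; first exact: esym (ec b).
by have /= := ed b; rewrite !ec.
Qed.

(** Dual bases change sides over the converse ring, so results on left modules transfer to right
    modules. *)
Definition rbasis_converse (L B : pzRingType) (bL : {rmorphism B -> L}) Q J
    (b : lbasis bL Q J) : @rbasis L^c B^c (converse_rmorphism bL) Q J :=
  @RBasis L^c B^c (converse_rmorphism bL) Q J (lb_elt b) (lb_coef b)
    (lb_in b) (lb_coefD b) (fun j x c => lb_coefM b j c x) (lb_sum b).

Definition lbasis_converse (L B : pzRingType) (bL : {rmorphism B -> L}) Q J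
    (b : rbasis bL Q J) : @lbasis L^c B^c (converse_rmorphism bL) Q J :=
  @LBasis L^c B^c (converse_rmorphism bL) Q J (rb_elt b) (rb_coef b)
    (rb_in b) (rb_coefD b) (fun j c x => rb_coefM b j x c) (rb_sum b).

(** * Dual bases of finitely generated projective modules *)

(** The free module on the generators maps onto [P]; the coordinates of a section are the required
    functionals. *)
Lemma projective_dual_basis (R : pzRingType) (P : lmodType R) k
    (g : 'I_k -> P) :
  projective P -> (forall x, exists c : 'I_k -> R, x = \sum_i c i *: g i) ->
  exists f : 'I_k -> P -> R,
    [/\ forall i, {morph f i : x y / x + y},
        forall i a x, f i (a *: x) = a * f i x
      & forall x, \sum_i f i x *: g i = x].
Proof.
move=> projP gen.
have qlin : linear (fun y : 'I_k -> R^o => \sum_i (y i : R) *: g i).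
  move=> a x y; rewrite scaler_sumr -big_split /=.
  by apply: eq_bigr => i _; rewrite !fctE scalerDl scalerA.
have [|h hE] := projP _ _ (lin qlin) idfun.
  by move=> x; have [c ->] := gen x; exists c.
exists (fun i x => h x i); split=> [i x y|i a x|x].
- by rewrite linearD.
- by rewrite linearZ.
- exact: hE.
Qed.

(** [beta] extends additively to the free group and kills every relation; vanishing of [x (x) y]
    says that its generator is a relation. *)
Lemma tensor_balanced0 (A : pzRingType) (X : lmodType A^c) (Y : lmodType A)
    (V : zmodType) (beta : X -> Y -> V) :
  zero_group (tensor X Y) ->
  (forall y, {morph beta^~ y : x x' / x + x'}) ->
  (forall x, {morph beta x : y y' / y + y'}) ->
  (forall x (a : A) y, beta ((a : A^c) *: x) y = beta x (a *: y)) ->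
  forall x y, beta x y = 0.
Proof.
move=> XY0 betaDl betaDr beta_balanced x y.
pose F := fglift (fun u : X * Y => beta u.1 u.2 : zmodule V).
have FB u v : F (u - v) = F u - F v by exact: lift_is_additive.
have FU u v : F << (u, v) >> = beta u v by rewrite /F liftU scale1r.
suff F0 w : tensor_rel w -> F w = 0.
  rewrite -FU; apply: F0.
  have /eqP := XY0 (tens x y).
  rewrite /tens -(raddf0 \pi_(tensor X Y)%qT) -Quotient.idealrBE subr0.
  by move/asboolP.
elim=> [u u' v|u v v'|u a v| |u1 v1 _ IHu _ IHv].
- by rewrite !FB !FU betaDl -addrA -opprD subrr.
- by rewrite !FB !FU betaDr -addrA -opprD subrr.
- by rewrite FB !FU beta_balanced subrr.
- by rewrite -(subrr 0) FB subrr.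
- by rewrite FB IHu IHv subrr.
Qed.

(** * The Morita ring as a split extension *)

Section MoritaSplit.
Variables (A : pzRingType) (N : bimodType A A).
Local Notation L := (morita0 N).
Local Notation B := (A * A)%type.

Definition morita_diag (b : B) : L := ((b.1, 0), (0, b.2)).
Definition morita_proj (x : L) : B := (x.1.1, x.2.2).
Definition morita_up (n : N) : L := ((0, n), (0, 0)).
Definition morita_low (n : N) : L := ((0, 0), (n, 0)).

Lemma morita_eq (x y : L) :
  x.1.1 = y.1.1 -> x.1.2 = y.1.2 -> x.2.1 = y.2.1 -> x.2.2 = y.2.2 -> x = y.
Proof.
by move: x y => [[a n] [m b]] [[a' n'] [m' b']] /= -> -> -> ->.
Qed.

Fact morita_diag_zmod_morphism : zmod_morphism morita_diag.
Proof. by move=> x y; apply: morita_eq => //=; rewrite subr0. Qed.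

Fact morita_diag_monoid_morphism : monoid_morphism morita_diag.
Proof.
split=> // x y; apply: morita_eq => //=.
  by rewrite scaler0 rscale0r addr0.
by rewrite scaler0 rscale0r addr0.
Qed.

HB.instance Definition _ := GRing.isZmodMorphism.Build B L morita_diag
  morita_diag_zmod_morphism.
HB.instance Definition _ := GRing.isMonoidMorphism.Build B L morita_diag
  morita_diag_monoid_morphism.

Fact morita_proj_zmod_morphism : zmod_morphism morita_proj.
Proof. by []. Qed.

Fact morita_proj_monoid_morphism : monoid_morphism morita_proj.
Proof. by split=> // -[[a n] [m b]] [[a' n'] [m' b']]. Qed.

HB.instance Definition _ := GRing.isZmodMorphism.Build L B morita_proj
  morita_proj_zmod_morphism.
HB.instance Definition _ := GRing.isMonoidMorphism.Build L B morita_proj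
  morita_proj_monoid_morphism.

Lemma morita_upD : {morph morita_up : m n / m + n}.
Proof. by move=> m n; apply: morita_eq => //=; rewrite addr0. Qed.

Lemma morita_lowD : {morph morita_low : m n / m + n}.
Proof. by move=> m n; apply: morita_eq => //=; rewrite addr0. Qed.

Lemma morita_split (x : L) :
  x = morita_diag (morita_proj x) + (morita_up x.1.2 + morita_low x.2.1).
Proof. by apply: morita_eq => /=; rewrite ?addr0 ?add0r. Qed.

Lemma mul_diag_up b n : morita_diag b * morita_up n = morita_up (b.1 *: n).
Proof.
by apply: morita_eq; rewrite /= ?mulr0 ?rscaler0 ?scaler0 ?addr0.
Qed.

Lemma mul_diag_low b n : morita_diag b * morita_low n = morita_low (b.2 *: n).
Proof.
by apply: morita_eq; rewrite /= ?mulr0 ?rscaler0 ?scaler0 ?addr0 ?add0r.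
Qed.

Lemma mul_up_diag n b : morita_up n * morita_diag b = morita_up (rscale n b.2).
Proof.
apply: morita_eq;
  by rewrite /= ?mul0r ?rscale0r ?scaler0 ?scale0r ?addr0 ?add0r.
Qed.

Lemma mul_low_diag n b :
  morita_low n * morita_diag b = morita_low (rscale n b.1).
Proof.
apply: morita_eq;
  by rewrite /= ?mul0r ?rscale0r ?scaler0 ?scale0r ?addr0 ?add0r.
Qed.

Section Bases.
Variables (k : nat) (g : 'I_k -> N) (f : 'I_k -> N -> A).
Hypothesis fD : forall i, {morph f i : x y / x + y}.
Local Notation J := ('I_1 + ('I_k + 'I_k))%type.

Definition morita_elt (j : J) : L :=
  match j with
  | inl _ => 1
  | inr (inl i) => morita_up (g i)
  | inr (inr i) => morita_low (g i)
  end.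

Section Left.
Hypothesis fM : forall i a x, f i (a *: x) = a * f i x.
Hypothesis fg : forall x, \sum_i f i x *: g i = x.

Definition morita_lcoef (j : J) (x : L) : B :=
  match j with
  | inl _ => morita_proj x
  | inr (inl i) => (f i x.1.2, 0)
  | inr (inr i) => (0, f i x.2.1)
  end.

Fact morita_lcoefD j : {morph morita_lcoef j : x y / x + y}.
Proof.
by case: j => [u|[i|i]] x y //=; rewrite fD; congr (_, _); rewrite /= addr0.
Qed.

Fact morita_lcoefM j b x :
  morita_lcoef j (morita_diag b * x) = b * morita_lcoef j x.
Proof.
move: x b => [[a n] [m c]] [b1 b2]; case: j => [u|[i|i]]; congr (_, _) => /=.
- by rewrite rscale0r addr0 fM.
- by rewrite mulr0.
- by rewrite mulr0.
- by rewrite rscale0r add0r fM.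
Qed.

Fact morita_lsum x :
  True -> \sum_j morita_diag (morita_lcoef j x) * morita_elt j = x.
Proof.
move=> _; rewrite !big_sumType /= big_ord1 /= mulr1 [RHS]morita_split.
congr (_ + (_ + _)).
  under eq_bigr do rewrite mul_diag_up.
  by rewrite -(morphD_sum morita_upD) fg.
under eq_bigr do rewrite mul_diag_low.
by rewrite -(morphD_sum morita_lowD) fg.
Qed.

Definition morita_lbasis : lbasis morita_diag (fun=> True) J :=
  LBasis (fun _ => I) morita_lcoefD morita_lcoefM morita_lsum.

End Left.

Section Right.
Hypothesis fM : forall i x a, f i (rscale x a) = f i x * a.
Hypothesis fg : forall x, \sum_i rscale (g i) (f i x) = x.

(** On the right the upper entry sees the second factor and the lower one the first, opposite to
    [morita_lcoef]. *)
Definition morita_rcoef (j : J) (x : L) : B :=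
  match j with
  | inl _ => morita_proj x
  | inr (inl i) => (0, f i x.1.2)
  | inr (inr i) => (f i x.2.1, 0)
  end.

Fact morita_rcoefD j : {morph morita_rcoef j : x y / x + y}.
Proof.
by case: j => [u|[i|i]] x y //=; rewrite fD; congr (_, _); rewrite /= addr0.
Qed.

Fact morita_rcoefM j x b :
  morita_rcoef j (x * morita_diag b) = morita_rcoef j x * b.
Proof.
move: x b => [[a n] [m c]] [b1 b2]; case: j => [u|[i|i]]; congr (_, _) => /=.
- by rewrite mul0r.
- by rewrite scaler0 add0r fM.
- by rewrite scaler0 addr0 fM.
- by rewrite mul0r.
Qed.

Fact morita_rsum x :
  True -> \sum_j morita_elt j * morita_diag (morita_rcoef j x) = x.
Proof.
move=> _; rewrite !big_sumType /= big_ord1 /= mul1r [RHS]morita_split.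
congr (_ + (_ + _)).
  under eq_bigr do rewrite mul_up_diag.
  by rewrite -(morphD_sum morita_upD) fg.
under eq_bigr do rewrite mul_low_diag.
by rewrite -(morphD_sum morita_lowD) fg.
Qed.

Definition morita_rbasis : rbasis morita_diag (fun=> True) J :=
  RBasis (fun _ => I) morita_rcoefD morita_rcoefM morita_rsum.

End Right.
End Bases.

(** Two elements of the same corner pair to zero, since a diagonal idempotent moved across fixes the
    first and kills the second; mixed pairings factor through [N (x)_A N]. *)
Lemma morita_tens_ker0 (V : zmodType) (beta : L -> L -> V) :
  zero_group (tensor (right_mod N) N) ->
  (forall y, {morph beta^~ y : x x' / x + x'}) ->
  (forall x, {morph beta x : y y' / y + y'}) ->
  (forall x b y, beta (x * morita_diag b) y = beta x (morita_diag b * y)) ->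
  forall x y, morita_proj x = 0 -> morita_proj y = 0 -> beta x y = 0.
Proof.
move=> NN0 betaDl betaDr beta_balanced x y x0 y0.
rewrite (morita_split x) (morita_split y) x0 y0 !rmorph0 !add0r.
have upup m n : beta (morita_up m) (morita_up n) = 0.
  have <- : morita_up m * morita_diag (0, 1) = morita_up m.
    by rewrite mul_up_diag rscaler1.
  rewrite beta_balanced mul_diag_up scale0r (morphD0 morita_upD).
  exact: (morphD0 (betaDr _)).
have lowlow m n : beta (morita_low m) (morita_low n) = 0.
  have <- : morita_low m * morita_diag (1, 0) = morita_low m.
    by rewrite mul_low_diag rscaler1.
  rewrite beta_balanced mul_diag_low scale0r (morphD0 morita_lowD).
  exact: (morphD0 (betaDr _)).
have uplow m n : beta (morita_up m) (morita_low n) = 0.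
  apply: (tensor_balanced0 (X := right_mod N) (Y := N)
    (beta := fun m n => beta (morita_up m) (morita_low n))) => //.
  - by move=> n1 m1 m2; rewrite morita_upD betaDl.
  - by move=> m1 n1 n2; rewrite morita_lowD betaDr.
  - move=> m1 a n1; have /= <- := mul_up_diag m1 (0, a).
    by rewrite beta_balanced mul_diag_low.
have lowup m n : beta (morita_low m) (morita_up n) = 0.
  apply: (tensor_balanced0 (X := right_mod N) (Y := N)
    (beta := fun m n => beta (morita_low m) (morita_up n))) => //.
  - by move=> n1 m1 m2; rewrite morita_lowD betaDl.
  - by move=> m1 n1 n2; rewrite morita_upD betaDr.
  - move=> m1 a n1; have /= <- := mul_low_diag m1 (a, 0).
    by rewrite beta_balanced mul_diag_up.
by rewrite betaDl !betaDr upup uplow lowup lowlow !addr0.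
Qed.

Lemma morita_artin_generators : artin_algebra L ->
  exists k (g : 'I_k -> N),
    (forall x, exists c : 'I_k -> A, x = \sum_i c i *: g i) /\
    (forall x, exists c : 'I_k -> A, x = \sum_i rscale (g i) (c i)).
Proof.
move=> [R [f [_ fC [k [g gen]]]]]; exists k, (fun i => (g i).1.2).
(* Commuting with a diagonal idempotent kills the off-diagonal entries of [f r]. *)
have f_diag r : f r = morita_diag (morita_proj (f r)).
  have := fC r (morita_diag (1, 0)).
  case: (f r) => [[a n] [m b]] /(congr1 (fun x : L => (x.1.2, x.2.1))) /=.
  rewrite !scaler0 !scale0r !rscaler0 !rscale0r !rscaler1 !scale1r.
  rewrite !add0r !addr0.
  by move=> [<- ->].
have upD : {morph (fun x : L => x.1.2) : x y / x + y} by [].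
split=> x; have [c cE] := gen (morita_up x).
  exists (fun i => (f (c i)).1.1); rewrite -[LHS]/((morita_up x).1.2) cE.
  rewrite (morphD_sum upD); apply: eq_bigr => i _; rewrite f_diag.
  by case: (g i) => [[a n] [m b]]; rewrite /= rscale0r addr0.
(* Centrality moves [f (c i)] to the right of [g i], where its lower diagonal entry is the one that
   acts. *)
exists (fun i => (f (c i)).2.2); rewrite -[LHS]/((morita_up x).1.2) cE.
rewrite (morphD_sum upD); apply: eq_bigr => i _; rewrite fC f_diag.
by case: (g i) => [[a n] [m b]]; rewrite /= scaler0 add0r.
Qed.

End MoritaSplit.

(** * The product ring [A * A] and its two factors *)

Section ProductRing.
Variable A : pzRingType.

Definition pair_diag (a : A) : A * A := (a, a).

Fact pair_diag_zmod_morphism : zmod_morphism pair_diag.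
Proof. by []. Qed.
Fact pair_diag_monoid_morphism : monoid_morphism pair_diag.
Proof. by []. Qed.

HB.instance Definition _ := GRing.isZmodMorphism.Build A (A * A)%type pair_diag
  pair_diag_zmod_morphism.
HB.instance Definition _ := GRing.isMonoidMorphism.Build A (A * A)%type
  pair_diag pair_diag_monoid_morphism.

Lemma fst_factor : @ring_factor A (A * A)%type pair_diag fst (1, 0).
Proof.
by split=> // b; congr (_, _); rewrite /= ?mul1r ?mulr1 ?mul0r ?mulr0.
Qed.

Lemma snd_factor : @ring_factor A (A * A)%type pair_diag snd (0, 1).
Proof.
by split=> // b; congr (_, _); rewrite /= ?mul1r ?mulr1 ?mul0r ?mulr0.
Qed.

Lemma pair_idempotents : ((1, 0) + (0, 1) : A * A) = 1.
Proof. by congr (_, _); rewrite /= ?addr0 ?add0r. Qed.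

End ProductRing.

Theorem corollary4p15 (A : pzRingType) (N : bimodType A A)
    (artinL : artin_algebra (morita0 N))
    (projNr : projective (right_mod N : lmodType A^c))
    (projNl : projective (N : lmodType A))
    (tensNN : zero_group (tensor (right_mod N) N)) :
  (gorenstein A -> gorenstein (morita0 N)) /\
  (finite_gldim A -> finite_gldim (morita0 N)).
Proof.
have [k [g [genl genr]]] := morita_artin_generators artinL.
have [fl [flD flM flg]] := projective_dual_basis projNl genl.
have [fr [frD frM frg]] := projective_dual_basis projNr genr.
pose lb := morita_lbasis flD flM flg.
pose rb := morita_rbasis frD (fun i x a => frM i a x) frg.
pose fac1 := fst_factor A; pose fac2 := snd_factor A.
have proj_diag b : @morita_proj A N (morita_diag N b) = b by case: b.
split=> [[idl idr]|gldimA]; last first.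
  apply: (finite_gldim_split_extension proj_diag rb).
    by move=> V beta *; apply: (morita_tens_ker0 (beta := beta)).
  exact: finite_gldim_factors fac1 fac2 (pair_idempotents A) gldimA.
split.
  apply: (finite_id_split_extension proj_diag lb rb).
    by move=> V beta *; apply: (morita_tens_ker0 (beta := beta)).
  exact: finite_id_factors fac1 fac2 (pair_idempotents A) idl.
(* The right-hand half is the left-hand one over the converse ring: the dual bases change sides and
   the pairing takes its arguments in the opposite order. *)
have proj_diag_c b : converse_rmorphism (@morita_proj A N)
  (converse_rmorphism (@morita_diag A N) b) = b by case: b.
apply: (finite_id_split_extension proj_diag_c (lbasis_converse rb)
  (rbasis_converse lb)).
  move=> V beta betaDl betaDr beta_balanced x y x0 y0.
  apply: (morita_tens_ker0 (beta := fun y x => beta x y)) => //.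
  by move=> x1 b y1; rewrite -beta_balanced.
exact: finite_id_factors (ring_factor_converse fac1)
  (ring_factor_converse fac2) (pair_idempotents A) idr.
Qed.
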